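(* Let $(\Gamma,\pi)$ be a weighted graph with vertex set $G$ and let $(\theta_x)_{x\in G}$ be positive vertex weights such that $\sum_{x\in U}\theta_x=\infty$ for every infinite connected $U\subset G$. If there exists a metric $\rho$ on $G$ adapted to $\mathcal{L}_\theta$ such that $VG(\Gamma,\pi,\theta,\rho)<\infty$, then the essential spectrum of $-\mathcal{L}_\theta$ is nonempty.
   Context: Graph: $\Gamma=(G,E)$ is an unoriented, connected, countably infinite, locally finite graph without loops or multiple edges; $x\sim y$ means $\{x,y\}\in E$. A subset $U\subset G$ is connected if it induces a connected subgraph. Edge weights: $\pi_{xy}=\pi_{yx}\ge 0$ for $x,y\in G$, with $\pi_{xy}>0$ if and only if $\{x,y\}\in E$; $(\Gamma,\pi)$ is then called a weighted graph. Operator: $L^2(\theta)$ is the real Hilbert space with inner product $\langle f,g\rangle_{L^2(\theta)}=\sum_{x\in G}f(x)g(x)\theta_x$. The operator $\mathcal{L}_\theta$ is given by $(\mathcal{L}_\theta f)(x)=\frac{1}{\theta_x}\sum_{y\sim x}\pi_{xy}(f(y)-f(x))$ on the domain $\{f\in L^2(\theta):\mathcal{L}_\theta f\in L^2(\theta)\}$. Under the stated condition on $\theta$, $-\mathcal{L}_\theta$ is a nonnegative self-adjoint operator; it is minus the generator of the Dirichlet form $\mathcal{E}(f,g)=\frac12\sum_{x,y\in G}\pi_{xy}(f(y)-f(x))(g(y)-g(x))$ whose domain $\mathcal{D}(\mathcal{E})$ is the closure of the finitely supported functions $C_c(G)$ in the norm $(\|f\|_{L^2(\theta)}^2+\mathcal{E}(f,f))^{1/2}$.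 It may be unbounded. Adapted metric: a metric $\rho$ on $G$ is adapted to $\mathcal{L}_\theta$ on $(\Gamma,\pi)$ if $\frac{1}{\theta_x}\sum_{y\sim x}\pi_{xy}\rho^2(x,y)\le 1$ for all $x\in G$, and there is $c_\rho>0$ such that $\rho(x,y)\le c_\rho$ whenever $x\sim y$. Volume growth: $B_\rho(x_0,r)=\{x\in G:\rho(x_0,x)\le r\}$, $V_\rho(x_0,r)=\sum_{x\in B_\rho(x_0,r)}\theta_x\in(0,\infty]$, and $VG(\Gamma,\pi,\theta,\rho)=\limsup_{r\to\infty}\frac1r\log V_\rho(x_0,r)$, which does not depend on $x_0\in G$. Spectrum: the essential spectrum of $-\mathcal{L}_\theta$ consists of the points of its spectrum that are accumulation points of the spectrum or isolated eigenvalues of infinite multiplicity. *)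

(* Defs.v *)
From HB Require Import structures.
From mathcomp Require Import all_boot all_order all_algebra.
From mathcomp Require Import all_classical all_reals all_analysis.
Set Implicit Arguments.
Unset Strict Implicit.
Unset Printing Implicit Defensive.
Import Order.TTheory GRing.Theory Num.Theory.
Import numFieldNormedType.Exports.
Local Open Scope classical_set_scope.
Local Open Scope ring_scope.

Section WeightedGraphs.
Variables (R : realType) (G : countType).
Implicit Types (E : rel G) (pi rho : G -> G -> R) (theta f : G -> R).
Implicit Types (U : set G) (x y : G).

Definition nbrs E x : set G := [set y | E x y].

Definition graph_connected E U : Prop :=
  forall x y, U x -> U y ->
    exists s : seq G, [/\ path E x s, last x s = y & [set` s] `<=` U].

Record is_graph E : Prop := IsGraph {
  edge_sym : symmetric E;
  edge_irr : irreflexive E;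
  edge_locally_finite : forall x, finite_set (nbrs E x);
  edge_connected : graph_connected E [set: G];
  vertices_infinite : infinite_set [set: G]
}.

Record is_edge_weight E pi : Prop := IsEdgeWeight {
  weight_sym : forall x y, pi x y = pi y x;
  weight_ge0 : forall x y, 0 <= pi x y;
  weight_gt0 : forall x y, 0 < pi x y <-> E x y
}.

(* A finite sum, by local finiteness (\sum_(y \in A) is 0 on infinite supports). *)
Definition laplacian E pi theta f : G -> R := fun x =>
  (theta x)^-1 * \sum_(y \in nbrs E x) (pi x y * (f y - f x)).

Record is_metric rho : Prop := IsMetric {
  metric_ge0 : forall x y, 0 <= rho x y;
  metric_eq0 : forall x y, rho x y = 0 <-> x = y;
  metric_sym : forall x y, rho x y = rho y x;
  metric_triangle : forall x y z, rho x z <= rho x y + rho y z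
}.

Definition adapted E pi theta rho : Prop :=
  (forall x, (theta x)^-1 * \sum_(y \in nbrs E x) (pi x y * rho x y ^+ 2) <= 1)
  /\ exists2 c : R, 0 < c & forall x y, E x y -> rho x y <= c.

Definition closed_rho_ball rho x (r : R) : set G := [set y | rho x y <= r].

Definition mass theta U : \bar R := (\esum_(x in U) (theta x)%:E)%E.

Definition volume_growth theta rho x0 : \bar R :=
  limf_esup (fun r : R =>
    ((r^-1)%:E * lne (mass theta (closed_rho_ball rho x0 r)))%E)
  (pinfty_nbhs R).

End WeightedGraphs.

Section Spectrum.
Variables (R : realType) (G : countType) (theta : G -> R).
Implicit Types (f g : G -> R) (D : set (G -> R)) (A : (G -> R) -> G -> R).

Definition l2normsq f : \bar R :=
  (\esum_(x in [set: G]) (f x ^+ 2 * theta x)%:E)%E.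

Definition L2 : set (G -> R) := [set f | (l2normsq f < +oo)%E].

Definition l2norm f : R := Num.sqrt (fine (l2normsq f)).

(* Below, an operator A of L2 with domain D is a total map on functions, of
   which only the restriction to D matters. As L2 is a real Hilbert space, the
   spectrum is a subset of R. *)

Definition resolvent_set D A : set R := [set l |
  (forall g, L2 g -> exists! f, D f /\ (fun x => A f x - l * f x) = g) /\
  exists C : R, forall f, D f ->
    l2norm f <= C * l2norm (fun x => A f x - l * f x)].

Definition spectrum D A : set R := ~` resolvent_set D A.

Definition eigenspace D A (l : R) : set (G -> R) :=
  [set f | D f /\ forall x, A f x = l * f x].

Definition infinite_dimensional (V : set (G -> R)) : Prop :=
  forall n, exists e : 'I_n -> G -> R, (forall i, V (e i)) /\
    forall c : 'I_n -> R,
      (forall x, \sum_(i < n) c i * e i x = 0) -> forall i, c i = 0.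

Definition essential_spectrum D A : set R := [set l | spectrum D A l /\
  (limit_point (spectrum D A) l \/
   isolated (spectrum D A) l /\ infinite_dimensional (eigenspace D A l))].

End Spectrum.

Section LaplacianOperator.
Variables (R : realType) (G : countType).
Variables (E : rel G) (pi : G -> G -> R) (theta : G -> R).

Definition laplacian_dom : set (G -> R) :=
  [set f | L2 theta f /\ L2 theta (laplacian E pi theta f)].

Definition neg_laplacian (f : G -> R) : G -> R :=
  fun x => - laplacian E pi theta f x.

End LaplacianOperator.

(* Main.v *)
Require Import Defs.
From HB Require Import structures.
From mathcomp Require Import all_boot all_order all_algebra finmap.
From mathcomp Require Import all_classical all_reals all_analysis.
From mathcomp Require Import ring lra.
Import Order.TTheory GRing.Theory Num.Theory.
Import numFieldNormedType.Exports.
Local Open Scope classical_set_scope.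
Local Open Scope ring_scope.
Set Implicit Arguments.
Unset Strict Implicit.
Unset Printing Implicit Defensive.

(* Suppose the essential spectrum is empty, so that the spectrum is discrete
   with finite-dimensional eigenspaces. Let M be the supremum of the numbers m
   such that <-Lf, f> >= m |f|^2 for all f in the domain orthogonal to some
   finite set of eigenfunctions. If M were finite, the part of -L orthogonal to
   finitely many eigenfunctions, those at M included, would be bounded below by
   M and have no spectrum near M, hence be bounded below by more than M: a
   contradiction. So the Rayleigh quotient tends to infinity along weakly null
   sequences.

   On the other hand let F_j = exp (a (j - |rho(x0, .) - j|)) with 2a larger
   than the volume growth. Then F_j is in L^2, its energy is at most
   C a^2 |F_j|^2 because rho is adapted, |F_j|^2 tends to infinity since G has
   infinite mass, and F_j <= exp (a rho(x0, .)) stays bounded at each vertex.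
   Normalized, the F_j are weakly null with bounded Rayleigh quotients. They
   can be replaced by finitely supported functions since the components of
   {F_j >= eta}, a set of finite mass, are finite.

   The same finiteness of components gives, by the maximum principle, that
   -L + 1 is injective on L^2; hence finitely supported functions form a core
   and -L is symmetric and nonnegative on its maximal domain. *)

(** * Inner product spaces *)

(** Evaluate at the minimizer [- b / a]; if [a = 0], a nonzero [b] would allow the value [- 1].
    Applied to nonnegative forms, this yields the Cauchy-Schwarz inequalities used below. *)
Lemma discr_le (R : realType) (a b c : R) : 0 <= a ->
  (forall t, 0 <= a * t ^+ 2 + 2 * b * t + c) -> b ^+ 2 <= a * c.
Proof.
move=> a0 h; have [a_eq0|an0] := eqVneq a 0.
  have [->|bn0] := eqVneq b 0; first by rewrite a_eq0 expr0n /= mul0r.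
  have := h (- (c + 1) / (2 * b)); rewrite a_eq0.
  have -> : 0 * (- (c + 1) / (2 * b)) ^+ 2 + 2 * b * (- (c + 1) / (2 * b)) + c =
     - 1 by field.
  by lra.
have {}a0 : 0 < a by rewrite lt_neqAle eq_sym an0.
have := h (- b / a).
have -> : a * (- b / a) ^+ 2 + 2 * b * (- b / a) + c = (a * c - b ^+ 2) / a.
  by field.
by rewrite pmulr_lge0 ?invr_gt0// subr_ge0.
Qed.

(** A continuity argument standing in for the spectral theorem: the set of valid lower bounds is
    downward closed and contains its supremum, and the last hypothesis pushes it upward as long as
    [t < b]. *)
Lemma form_threshold (R : realType) (X : Type) (N : set X) (Q n : X -> R)
    (a b : R) :
  (forall f, 0 <= n f) ->
  (forall f, N f -> a * n f <= Q f) ->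
  (forall t, a <= t -> t < b -> (forall f, N f -> t * n f <= Q f) ->
    exists2 k, 0 < k & forall f, N f -> (t + k) * n f <= Q f) ->
  forall f, N f -> b * n f <= Q f.
Proof.
move=> n0 Qa step.
pose T := [set t | forall f, N f -> t * n f <= Q f].
have down x y : T y -> x <= y -> T x.
  by move=> Ty xy f /Ty; apply: le_trans; apply: ler_wpM2r.
have [//|nTb] := pselect (T b).
have ub : ubound T b.
  by move=> y Ty; rewrite leNgt; apply/negP => /ltW /(down _ _ Ty).
have Ta : T a by [].
have hs : has_sup T by split; [exists a | exists b].
have below y : y < sup T -> T y.
  move=> ys; have [z Tz yz] := sup_adherent (eps := sup T - y) ltac:(lra) hs.
  by apply: (down _ z Tz); lra.
(* If [Q f] were below [sup T * n f], the midpoint of [Q f / n f] and [sup T] would still be a valid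
   bound, which [f] violates. The bound at [a] excludes [n f = 0]. *)
have Ts : T (sup T).
  move=> f Nf; rewrite leNgt; apply/negP => h.
  have nf : 0 < n f.
    rewrite lt_neqAle n0 andbT; apply/eqP => nf0.
    by have := Qa _ Nf; move: h; rewrite -nf0 !mulr0; lra.
  have hy : Q f / n f < sup T by rewrite ltr_pdivrMr.
  have := below ((Q f / n f + sup T) / 2) ltac:(lra) f Nf.
  rewrite leNgt => /negP; apply.
  by rewrite -ltr_pdivrMr//; lra.
have as_ : a <= sup T by apply: ub_le_sup Ta; exists b.
have sb : sup T <= b by apply: ge_sup => //; exists a.
have [sb'|] := ltP (sup T) b; last by move=> bs; have := down _ _ Ts bs.
have [k k0 Tk] := step _ as_ sb' Ts.
have : sup T + k <= sup T by apply: ub_le_sup Tk; exists b.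
by lra.
Qed.

Record inner_product (R : realType) (V : lmodType R) := InnerProduct {
  ip :> V -> V -> R;
  ipC : forall f g, ip f g = ip g f;
  ipDl : forall f g h, ip (f + g) h = ip f h + ip g h;
  ipZl : forall c f g, ip (c *: f) g = c * ip f g;
  ip_ge0 : forall f, 0 <= ip f f;
  ip_eq0 : forall f, ip f f = 0 -> f = 0 }.

Section InnerProductTheory.
Variables (R : realType) (V : lmodType R) (dot : inner_product V).
Implicit Types f g h : V.

Lemma ipDr f g h : dot f (g + h) = dot f g + dot f h.
Proof. by rewrite ipC ipDl !(ipC _ f). Qed.
Lemma ipZr c f g : dot f (c *: g) = c * dot f g.
Proof. by rewrite ipC ipZl ipC. Qed.
Lemma ipNl f g : dot (- f) g = - dot f g.
Proof. by rewrite -scaleN1r ipZl mulN1r. Qed.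
Lemma ipNr f g : dot f (- g) = - dot f g.
Proof. by rewrite ipC ipNl ipC. Qed.
Lemma ip0l f : dot 0 f = 0.
Proof. by rewrite -(scale0r 0) ipZl mul0r. Qed.
Lemma ip0r f : dot f 0 = 0.
Proof. by rewrite ipC ip0l. Qed.
Definition ipE := (ipDl, ipDr, ipZl, ipZr, ipNl, ipNr).

Lemma cauchy_schwarz f g : dot f g ^+ 2 <= dot f f * dot g g.
Proof.
rewrite mulrC; apply: discr_le => [|t]; first exact: ip_ge0.
have := ip_ge0 dot (f + t *: g); rewrite !ipE (ipC dot g f).
by congr (0 <= _); ring.
Qed.

Definition nrm f : R := Num.sqrt (dot f f).

Lemma nrm_ge0 f : 0 <= nrm f. Proof. exact: sqrtr_ge0. Qed.
Lemma nrm_sqr f : nrm f ^+ 2 = dot f f.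
Proof. by rewrite sqr_sqrtr// ip_ge0. Qed.
Lemma nrm0_eq0 f : nrm f = 0 -> f = 0.
Proof. by move=> h; apply: (@ip_eq0 _ _ dot); rewrite -nrm_sqr h expr0n. Qed.
Lemma nrm0 : nrm 0 = 0.
Proof. by rewrite /nrm ip0l sqrtr0. Qed.
Lemma nrmZ c f : nrm (c *: f) = `|c| * nrm f.
Proof.
by rewrite /nrm !ipE mulrA -expr2 sqrtrM ?sqr_ge0// sqrtr_sqr.
Qed.
Lemma nrmN f : nrm (- f) = nrm f.
Proof. by rewrite /nrm !ipE opprK. Qed.
Lemma nrm_distC f g : nrm (f - g) = nrm (g - f).
Proof. by rewrite -nrmN opprB. Qed.

Lemma dot_nrm f g : `|dot f g| <= nrm f * nrm g.
Proof.
rewrite -[X in _ <= X]ger0_norm ?mulr_ge0 ?nrm_ge0//.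
rewrite -ler_sqr ?nnegrE ?normr_ge0// !real_normK ?num_real//.
by rewrite exprMn !nrm_sqr cauchy_schwarz.
Qed.

Lemma nrm_triangle f g : nrm (f + g) <= nrm f + nrm g.
Proof.
rewrite -ler_sqr ?nnegrE ?addr_ge0 ?nrm_ge0//.
rewrite sqrrD !nrm_sqr !ipE (ipC _ g f).
have := le_trans (ler_norm _) (dot_nrm f g); lra.
Qed.

Lemma nrm_triangleB f g h : nrm (f - h) <= nrm (f - g) + nrm (g - h).
Proof. by apply: le_trans (nrm_triangle _ _); rewrite addrA subrK. Qed.

Definition nrm_cvg (u : nat -> V) l := forall e, 0 < e ->
  exists n, forall i, (n <= i)%N -> nrm (u i - l) <= e.

Definition nrm_cauchy (u : nat -> V) := forall e, 0 < e ->
  exists n, forall i j, (n <= i)%N -> (n <= j)%N -> nrm (u i - u j) <= e.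

Definition complete_ip := forall u, nrm_cauchy u -> exists l, nrm_cvg u l.

(** Since [e <= 1], [nrm g'] is at most [nrm g + 1]; the error is then linear in [e] with a constant
    that involves only [f] and [g]. *)
Lemma dot_approx f g f' g' e : nrm (f - f') <= e -> nrm (g - g') <= e ->
  e <= 1 -> `|dot f g - dot f' g'| <= e * (nrm f + nrm g + 1).
Proof.
move=> hf hg e1.
have -> : dot f g - dot f' g' = dot (f - f') g' + dot f (g - g').
  by rewrite !ipE; ring.
apply: le_trans (ler_normD _ _) _.
have e0 : 0 <= e by apply: le_trans hf; exact: nrm_ge0.
have g'1 : nrm g' <= nrm g + 1.
  have := nrm_triangle g (g' - g); rewrite addrC subrK (nrm_distC g'); lra.
have h1 := le_trans (dot_nrm (f - f') g') (ler_pM (nrm_ge0 _) (nrm_ge0 _) hf g'1).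
have h2 := le_trans (dot_nrm f (g - g')) (ler_pM (nrm_ge0 _) (nrm_ge0 _) (lexx _) hg).
lra.
Qed.

End InnerProductTheory.

(** * Spectral gaps of symmetric operators *)

Section LinearOn.
Variables (R : realType) (V : lmodType R).
Implicit Types (D : set V) (A : V -> V).

(** An unbounded operator is a total map of which linearity is asked on the subspace [D] only. *)
Record linear_on D A : Prop := LinearOn {
  dom0 : D 0;
  dom_lin : forall c f g, D f -> D g -> D (c *: f + g);
  op_lin : forall c f g, D f -> D g -> A (c *: f + g) = c *: A f + A g }.

Variables (D : set V) (A : V -> V) (linA : linear_on D A).

Lemma domZ c f : D f -> D (c *: f).
Proof.
move=> Df; rewrite -[_ *: _]addr0.
by apply: (dom_lin linA) => //; apply: (dom0 linA).
Qed.
Lemma domD f g : D f -> D g -> D (f + g).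
Proof. by move=> Df Dg; rewrite -[f]scale1r; apply: (dom_lin linA). Qed.
Lemma domN f : D f -> D (- f).
Proof. by rewrite -scaleN1r; apply: domZ. Qed.
Lemma domB f g : D f -> D g -> D (f - g).
Proof. by move=> Df Dg; apply: domD => //; apply: domN. Qed.
Lemma opD f g : D f -> D g -> A (f + g) = A f + A g.
Proof. by move=> Df Dg; rewrite -[f]scale1r (op_lin linA)// !scale1r. Qed.
Lemma op0 : A 0 = 0.
Proof.
apply: (addrI (A 0)); rewrite -opD ?addr0//; exact: (dom0 linA).
Qed.
Lemma opZ c f : D f -> A (c *: f) = c *: A f.
Proof.
move=> Df; rewrite -[_ *: f]addr0 (op_lin linA) ?op0 ?addr0//.
exact: (dom0 linA).
Qed.
Lemma opN f : D f -> A (- f) = - A f.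
Proof. by move=> Df; rewrite -scaleN1r opZ// scaleN1r. Qed.
Lemma opB f g : D f -> D g -> A (f - g) = A f - A g.
Proof. by move=> Df Dg; rewrite opD ?opN//; apply: domN. Qed.

Lemma linear_on_shift c : linear_on D (fun f => A f - c *: f).
Proof.
split=> [|u f g Df Dg|u f g Df Dg]; first exact: (dom0 linA).
  exact: (dom_lin linA).
rewrite (op_lin linA)// scalerBr scalerDr !scalerA [c * u]mulrC.
by rewrite opprD addrACA.
Qed.

End LinearOn.

(** * Lower bounds for quadratic forms from regular points *)

Section Operator.
Variables (R : realType) (V : lmodType R) (dot : inner_product V).
Variables (D : set V) (A : V -> V).
Hypothesis linA : linear_on D A.
Hypothesis symA : forall f g, D f -> D g -> dot (A f) g = dot f (A g).

Definition perp (s : seq V) : set V := [set f | forall e, e \in s -> dot e f = 0].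

Definition eigenseq (s : seq V) :=
  forall e, e \in s -> D e /\ exists l, A e = l *: e.

(** The estimate gives injectivity of [A - l] and the boundedness of its inverse at once. *)
Definition regular (l : R) :=
  (forall g, exists2 f, D f & A f - l *: f = g) /\
  (exists2 C, 0 < C & forall f, D f ->
     nrm dot f <= C * nrm dot (A f - l *: f)).

Lemma perp_lin s c f g : perp s f -> perp s g -> perp s (c *: f + g).
Proof. by move=> pf pg e es; rewrite !ipE pf// pg// mulr0 addr0. Qed.

Lemma regular_sqr l : regular l -> exists2 C, 0 < C & forall f, D f ->
  dot f f <= C * dot (A f - l *: f) (A f - l *: f).
Proof.
move=> [_ [C C0 h]]; exists (C ^+ 2); first by rewrite exprn_gt0.
move=> f Df; rewrite -!nrm_sqr -exprMn ler_sqr ?nnegrE ?nrm_ge0//.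
  exact: h.
by rewrite mulr_ge0 ?nrm_ge0// ltW.
Qed.

(** Pairing with an eigenvector [e] of eigenvalue [m] gives [(m - l) * dot e f = 0], and [m = l]
    would force [e = 0] because [l] is regular. So the resolvent preserves orthogonality to
    eigenvectors. *)
Lemma regular_perp s l f : eigenseq s -> regular l -> D f ->
  perp s (A f - l *: f) -> perp s f.
Proof.
move=> es rl Df pf e ein; have [De [m Ae]] := es _ ein.
have := pf _ ein; rewrite !ipE -symA// Ae !ipE => /eqP.
rewrite -mulrBl mulf_eq0 => /orP[|/eqP//].
rewrite subr_eq0 => /eqP ml; have [C C0 h] := regular_sqr rl.
have := h _ De; rewrite Ae ml subrr ip0l mulr0 => e0.
have /ip_eq0 -> : dot e e = 0 by apply/eqP; rewrite eq_le e0 ip_ge0.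
by rewrite ip0l.
Qed.

Lemma perp_op s f : eigenseq s -> D f -> perp s f -> perp s (A f).
Proof.
move=> es Df pf e ein; have [De [m Ae]] := es _ ein.
by rewrite -symA// Ae !ipE pf// mulr0.
Qed.

(** The common end of the two gap arguments below. Cauchy-Schwarz bounds [dot f g] by the square
    root of [K] times [dot f f]; the cruder factor [K + 1] avoids the root, and one [dot f f] then
    cancels. *)
Lemma form_lower_bound f g (P K : R) : 0 <= P -> 0 < K ->
  dot f f ^+ 2 <= P * dot f g -> dot g g <= K * dot f f ->
  (K + 1)^-1 * dot f f <= P.
Proof.
move=> P0 K0 h gg; have f0 := ip_ge0 dot f.
have fg : dot f g <= (K + 1) * dot f f.
  apply: (le_trans (ler_norm _)); rewrite -ler_sqr ?nnegrE//; last first.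
    by apply: mulr_ge0 => //; lra.
  rewrite real_normK ?num_real//; apply: le_trans (cauchy_schwarz _ _ _) _.
  rewrite exprMn.
  apply: (@le_trans _ _ (dot f f * (K * dot f f))); first exact: ler_wpM2l.
  have := sqr_ge0 (dot f f); nra.
rewrite ler_pdivrMl; last by lra.
have [->|fn0] := eqVneq (dot f f) 0; first by rewrite mulr_ge0//; lra.
have fp : 0 < dot f f by rewrite lt_neqAle eq_sym fn0.
rewrite -(ler_pM2r fp) -expr2; apply: (le_trans h).
by apply: le_trans (ler_wpM2l P0 fg) _; rewrite mulrCA mulrA.
Qed.

(* With g = (A - t)^-1 f the form <(A - t) f, g> is |f|^2, so by
   Cauchy-Schwarz the form cannot degenerate at a regular t. *)
Lemma bottom_gap s a b : eigenseq s -> (forall l, a <= l -> l < b -> regular l) ->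
  (forall f, D f /\ perp s f -> a * dot f f <= dot (A f) f) ->
  forall f, D f /\ perp s f -> b * dot f f <= dot (A f) f.
Proof.
move=> es reg ha.
apply: (form_threshold (N := [set f | D f /\ perp s f])
   (Q := fun f => dot (A f) f) (n := fun f => dot f f) (a := a)) => //.
  by move=> f; exact: ip_ge0.
move=> t at_ tb ht; have rt := reg _ at_ tb.
have [C C0 hC] := regular_sqr rt.
exists (C + 1)^-1; first by rewrite invr_gt0; lra.
move=> f [Df pf].
pose P h := dot (A h) h - t * dot h h.
have P0 h : D h /\ perp s h -> 0 <= P h by move=> /ht; rewrite subr_ge0.
have [g Dg gf] := rt.1 f.
have pg : perp s g by apply: (regular_perp es rt Dg); rewrite gf.
have gg : dot g g <= C * dot f f by rewrite -gf; exact: hC.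
have Agf : A g = f + t *: g by rewrite -gf subrK.
have Pg : P g = dot f g by rewrite /P Agf !ipE; ring.
have cs : dot f f ^+ 2 <= P g * P f.
  apply: discr_le => [|u]; first exact: P0.
  have := P0 (u *: g + f) (conj (dom_lin linA u Dg Df) (perp_lin u pg pf)).
  rewrite {1}/P (op_lin linA)// !ipE.
  have -> : dot (A f) g = dot f f + t * dot f g.
    by rewrite symA// Agf !ipE.
  rewrite Pg /P Agf !ipE (ipC dot g f).
  by congr (0 <= _); ring.
have : (C + 1)^-1 * dot f f <= P f.
  apply: (form_lower_bound (g := g)) => //; first exact: P0.
  by rewrite mulrC -Pg.
by rewrite /P; lra.
Qed.

(** The scheme of [bottom_gap] for the square of [B = A - c]: if [t = s ^+ 2 < r ^+ 2], both [c - s]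
    and [c + s] are regular, so B^2 - t = (B + s)(B - s) is invertible and the form |B f|^2 - t
    |f|^2 cannot degenerate. *)
Lemma gap_norm c r : 0 <= r -> (forall l, `|l - c| < r -> regular l) ->
  forall f, D f -> r ^+ 2 * dot f f <= dot (A f - c *: f) (A f - c *: f).
Proof.
move=> r0 reg.
apply: (form_threshold (N := D) (a := 0)
   (Q := fun f => dot (A f - c *: f) (A f - c *: f)) (n := fun f => dot f f)).
- by move=> f; exact: ip_ge0.
- by move=> f _; rewrite mul0r ip_ge0.
move=> t t0 tr ht.
pose B f := A f - c *: f.
have DB h k : D h -> D k -> dot (B h) k = dot h (B k).
  by move=> Dh Dk; rewrite /B !ipE symA.
pose s := Num.sqrt t.
have s2 : s ^+ 2 = t by rewrite sqr_sqrtr.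
have s0 : 0 <= s by exact: sqrtr_ge0.
have sr : s < r by rewrite -ltr_sqr ?nnegrE// s2.
have rp : regular (c + s) by apply: reg; rewrite ltr_norml; lra.
have rm : regular (c - s) by apply: reg; rewrite ltr_norml; lra.
have [C1 C10 hC1] := regular_sqr rp.
have [C2 C20 hC2] := regular_sqr rm.
pose K := C1 * C2.
have K0 : 0 < K by rewrite mulr_gt0.
exists (K + 1)^-1; first by rewrite invr_gt0; lra.
move=> f Df.
(* Two successive resolvents solve (B^2 - t) g = f: first (B + s) h = f, then (B - s) g = h. *)
have [h Dh hf] := rm.1 f.
have [g Dg gh] := rp.1 h.
have Bh : B h = f - s *: h.
  by rewrite /B -hf scalerBl opprB [s *: h - _]addrC addrA addrK.
have Bg : B g = h + s *: g.
  by rewrite /B -gh scalerDl opprD addrA subrK.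
have DBg : D (B g) by rewrite Bg; apply: (domD linA) => //; exact: (domZ linA).
have BBg : B (B g) = f + t *: g.
  have -> : B (B g) = s *: B g + B h.
    rewrite {1}Bg addrC; exact: (op_lin (linear_on_shift linA c)).
  by rewrite Bg Bh scalerDr scalerA -expr2 s2 addrC addrA subrK.
have gg : dot g g <= K * dot f f.
  apply: (le_trans (hC1 _ Dg)); rewrite gh /K -mulrA ler_pM2l//.
  by rewrite -hf; exact: hC2.
pose P h := dot (B h) (B h) - t * dot h h.
have P0 k : D k -> 0 <= P k by move=> /ht; rewrite subr_ge0.
have Pg : P g = dot f g by rewrite /P -DB// BBg !ipE; ring.
have cs : dot f f ^+ 2 <= P g * P f.
  apply: discr_le => [|u]; first exact: P0.
  have := P0 _ (dom_lin linA u Dg Df).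
  have Bl : B (u *: g + f) = u *: B g + B f.
    exact: (op_lin (linear_on_shift linA c)).
  have BfBg : dot (B f) (B g) = dot f f + t * dot f g.
    by rewrite DB// BBg !ipE.
  have BgBg : dot (B g) (B g) = dot f g + t * dot g g.
    by have := Pg; rewrite /P; lra.
  rewrite {1}/P Bl Pg /P; move: BfBg BgBg.
  move: (B g) (B f) => p q qp pp; rewrite !ipE (ipC dot p q) qp (ipC dot g f) pp.
  by congr (0 <= _); ring.
have : (K + 1)^-1 * dot f f <= P f.
  apply: (form_lower_bound (g := g)) => //; first exact: P0.
  by rewrite mulrC -Pg.
by rewrite /P; lra.
Qed.

End Operator.

(** * The gap above the kernel, and openness of the set of regular points *)

Section KernelGap.
Variables (R : realType) (V : lmodType R) (dot : inner_product V).
Variables (D : set V) (A : V -> V).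
Hypothesis linA : linear_on D A.
Hypothesis symA : forall f g, D f -> D g -> dot (A f) g = dot f (A g).

(** Cauchy-Schwarz for the form of [A] gives |A f|^4 <= <A A f, A f> <A f, f>. Multiplying by [d]
    and inserting the assumed inequality cancels one |A f|^2. *)
Lemma form_ge_on_range s (d : R) f : eigenseq D A s ->
  (forall h, D h -> perp dot s h -> 0 <= dot (A h) h) ->
  0 <= d -> d * dot (A f) f <= dot (A f) (A f) ->
  D f -> perp dot s f -> D (A f) ->
  d * dot (A f) (A f) <= dot (A (A f)) (A f).
Proof.
move=> es A0 d0 hd Df pf DAf.
have pAf : perp dot s (A f) by exact: (perp_op symA).
have cs : dot (A f) (A f) ^+ 2 <= dot (A (A f)) (A f) * dot (A f) f.
  apply: discr_le => [|u]; first exact: A0.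
  have := A0 _ (dom_lin linA u DAf Df) (perp_lin u pAf pf).
  rewrite (op_lin linA)//.
  have : dot (A (A f)) f = dot (A f) (A f) by rewrite symA.
  move: (A (A f)) (A f) => q p qf; rewrite !ipE qf.
  by congr (0 <= _); ring.
have [->|n0] := eqVneq (dot (A f) (A f)) 0; first by rewrite mulr0 A0.
have np : 0 < dot (A f) (A f) by rewrite lt_neqAle eq_sym n0 ip_ge0.
rewrite -(ler_pM2r np).
have := ler_wpM2l d0 cs; have := ler_wpM2l (A0 _ DAf pAf) hd; nra.
Qed.

(** Here g = J f and h = J g for J = t (A + t)^-1. The increment z = g - h is a multiple of A h,
    where the form is at least d = 2 t by [form_ge_on_range]; since f - g = z + A z / t, passing to
    the next increment at least halves the norm. The first estimate controls the initial increment
    by the form. *)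
Lemma resolvent_contraction s (d t : R) f g :
  eigenseq D A s -> (forall h, D h -> perp dot s h -> 0 <= dot (A h) h) ->
  0 < d -> t = d / 2 ->
  (forall h, D h -> d * dot (A h) h <= dot (A h) (A h)) ->
  D f -> perp dot s f -> D g -> perp dot s g -> A g = t *: (f - g) ->
  t * 2 * dot (f - g) (f - g) <= dot (A f) f /\
  forall h, D h -> perp dot s h -> A h = t *: (g - h) ->
    4 * dot (g - h) (g - h) <= dot (f - g) (f - g).
Proof.
move=> es A0 d0 td hd Df pf Dg pg Ag.
have t0 : 0 < t by lra.
have Dy : D (f - g) by exact: (domB linA).
have py : perp dot s (f - g).
  by rewrite addrC -scaleN1r; apply: perp_lin.
split=> [|h Dh ph Ah].
  have Af : A f = A (f - g) + t *: (f - g) by rewrite (opB linA)// -Ag subrK.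
  have gy : dot g (A (f - g)) = t * dot (f - g) (f - g).
    by rewrite -symA// Ag ipZl.
  have yy := A0 _ Dy py; have gg := A0 _ Dg pg.
  have -> : dot (A f) f = dot (A (f - g)) (f - g) + dot g (A (f - g))
     + t * dot (f - g) (f - g) + dot (A g) g.
    have -> : dot (A f) f = dot (A (f - g) + t *: (f - g)) (f - g + g).
      by rewrite -Af subrK.
    rewrite [LHS]ipDr !(ipDl _ (A _)) !(ipZl _ t) (ipC dot g) Ag ipZl; ring.
  by rewrite gy; lra.
have Dz : D (g - h) by exact: (domB linA).
have DAh : D (A h) by rewrite Ah; exact: (domZ linA).
have : d * dot (A h) (A h) <= dot (A (A h)) (A h).
  apply: (form_ge_on_range es) => //; [lra | exact: hd].
have : t *: (f - g) = t *: (g - h) + A (g - h).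
  by rewrite (opB linA)// Ag Ah [RHS]addrC subrK.
rewrite Ah (opZ linA)//; move: (f - g) (g - h) => y z; move: (A z) => p e.
rewrite !ipE => zz.
have : t ^+ 2 * dot y y = t ^+ 2 * dot z z + 2 * t * dot p z + dot p p.
  have : dot (t *: y) (t *: y) = dot (t *: z + p) (t *: z + p) by rewrite e.
  by rewrite !ipE (ipC dot z p) => h1; lra.
have t2 : 0 < t ^+ 2 by rewrite exprn_gt0.
have zp : d * dot z z <= dot p z.
  rewrite -(ler_pM2l t2); lra.
have pp := ip_ge0 dot p; have := ip_ge0 dot z => z0 e2.
rewrite -(ler_pM2l t2) e2.
have := ler_wpM2l (ltW t0) zp; rewrite td; nra.
Qed.

Lemma geometric_tail (x : nat -> V) (Y : R) :
  (forall k, nrm dot (x k - x k.+1) <= Y / 2 ^+ k) ->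
  forall k j, nrm dot (x k - x (k + j)%N) <= 2 * Y / 2 ^+ k.
Proof.
move=> h k j.
(* Subtracting the tail still to come makes the estimate stable under induction on [j]. *)
suff : nrm dot (x k - x (k + j)%N) <= 2 * Y / 2 ^+ k - 2 * Y / 2 ^+ (k + j).
  move=> /le_trans; apply; rewrite gerBl divr_ge0 ?exprn_ge0// mulr_ge0//.
  by have := h 0%N; rewrite expr0 divr1; apply: le_trans; exact: nrm_ge0.
elim: j => [|j IH]; first by rewrite addn0 !subrr nrm0.
apply: (le_trans (nrm_triangleB _ _ (x (k + j)%N) _)).
rewrite addnS; have := h (k + j)%N; rewrite exprS.
have p0 : (2 : R) ^+ (k + j) != 0 by rewrite expf_neq0.
have -> : 2 * Y / (2 * 2 ^+ (k + j)) = Y / 2 ^+ (k + j) by field.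
lra.
Qed.

Hypothesis complete : complete_ip dot.

Lemma geometric_cvg (x : nat -> V) (Y : R) :
  (forall k, nrm dot (x k - x k.+1) <= Y / 2 ^+ k) ->
  exists2 l, nrm_cvg dot x l & nrm dot (x 0%N - l) <= 2 * Y.
Proof.
move=> h; have tail := geometric_tail h.
have Y0 : 0 <= Y.
  by have := h 0%N; rewrite expr0 divr1; apply: le_trans; exact: nrm_ge0.
have small e : 0 < e -> exists n, 4 * Y / 2 ^+ n <= e.
  move=> e0; have [n hn] : exists n, 4 * Y / e < n%:R.
    exists (Num.bound (4 * Y / e)); apply: archi_boundP.
    by rewrite divr_ge0 ?mulr_ge0// ltW.
  exists n; rewrite ler_pdivrMr ?exprn_gt0// -ler_pdivrMl// mulrC.
  apply: ltW; apply: (lt_trans hn); rewrite -natrX ltr_nat; exact: ltn_expl.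
have [l xl] : exists l, nrm_cvg dot x l.
  apply: complete => e /small[n hn]; exists n => i j ni nj.
  apply: (le_trans (nrm_triangleB _ _ (x n) _)); rewrite nrm_distC.
  rewrite -(subnKC ni) -(subnKC nj).
  have := tail n (i - n)%N; have := tail n (j - n)%N; lra.
exists l => //; apply/ler_addgt0Pr => e /xl[n /(_ _ (leqnn n)) hn].
apply: (le_trans (nrm_triangleB _ _ (x n) _)).
by have := tail 0%N n; rewrite add0n expr0 divr1; lra.
Qed.

Lemma lipschitz_limit_fixed (T : V -> V) (K : R) (x : nat -> V) z : 0 <= K ->
  (forall f g, nrm dot (T f - T g) <= K * nrm dot (f - g)) ->
  (forall k, x k.+1 = T (x k)) -> nrm_cvg dot x z -> T z = z.
Proof.
move=> K0 lip xT xz; apply/eqP; rewrite -subr_eq0; apply/eqP.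
apply: (@nrm0_eq0 _ _ dot); apply/eqP; rewrite eq_le nrm_ge0 andbT.
apply/ler_addgt0Pr => e e0; rewrite add0r.
have K1 : 0 < K + 1 by lra.
have [n hn] := xz _ (divr_gt0 e0 K1).
apply: (le_trans (nrm_triangleB _ _ (x n.+1) _)).
have h1 : nrm dot (T z - x n.+1) <= K * (e / (K + 1)).
  rewrite xT; apply: le_trans (lip _ _) _.
  by rewrite ler_wpM2l// nrm_distC; exact: hn.
apply: le_trans (lerD h1 (hn n.+1 (leqnSn n))) _.
have <- : e = K * (e / (K + 1)) + e / (K + 1) by field; rewrite gt_eqF.
by [].
Qed.

(* Iterating the resolvent J = t (A + t)^-1 from f in perp s converges
   geometrically to an element of the kernel, hence to 0. *)
Lemma kernel_gap s (d : R) : eigenseq D A s ->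
  (forall h, D h -> perp dot s h -> 0 <= dot (A h) h) ->
  0 < d -> (forall l, 0 < `|l| -> `|l| < d -> regular dot D A l) ->
  (forall h, D h -> A h = 0 -> perp dot s h -> h = 0) ->
  exists2 k, 0 < k & forall f, D f -> perp dot s f -> k * dot f f <= dot (A f) f.
Proof.
move=> es A0 d0 reg ker.
pose t := d / 2; have t0 : 0 < t by rewrite /t; lra.
(* The interval from 0 to [d] is the ball of radius [t] around [t], so [gap_norm] applies with
   [c = t]; expanding |A h - t h|^2 >= t^2 |h|^2 gives the claim. *)
have gap h : D h -> d * dot (A h) h <= dot (A h) (A h).
  move=> Dh.
  have : t ^+ 2 * dot h h <= dot (A h - t *: h) (A h - t *: h).
    apply: (gap_norm linA symA) => //; first exact: ltW.
    move=> l; rewrite ltr_norml => /andP[l1 l2].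
    apply: reg; last by rewrite ltr_norml; rewrite /t in l1 l2 *; lra.
    by rewrite normr_gt0; apply/eqP; rewrite /t in l1 l2 *; lra.
  by rewrite !ipE (ipC dot h (A h)) /t; lra.
have rt : regular dot D A (- t).
  by apply: reg; rewrite normrN gtr0_norm// /t; lra.
have [J hJ] : {J : V -> V & forall g, D (J g) /\ A (J g) = t *: (g - J g)}.
  apply: (@choice _ _ (fun g j => D j /\ A j = t *: (g - j))) => g.
  have [f Df Af] := rt.1 (t *: g).
  exists f; split=> //; rewrite scalerBr -Af scaleNr opprK addrK//.
have Jperp g : perp dot s g -> perp dot s (J g).
  move=> pg; have [DJ AJ] := hJ g.
  apply: (regular_perp symA es rt DJ).
  rewrite AJ scaleNr opprK -scalerDr subrK.
  by move=> e es'; rewrite ipZr pg// mulr0.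
have [C C0 hC] := rt.2.
have Jlip g h : nrm dot (J g - J h) <= C * t * nrm dot (g - h).
  have [Dg Ag] := hJ g; have [Dh Ah] := hJ h.
  apply: le_trans (hC _ (domB linA Dg Dh)) _.
  rewrite -mulrA ler_pM2l// (opB linA)// Ag Ah scaleNr opprK -!scalerBr -scalerDr.
  rewrite nrmZ gtr0_norm//.
  suff -> : g - J g - (h - J h) + (J g - J h) = g - h by [].
  by rewrite opprB addrACA subrK addrAC subrr sub0r.
exists (t / 2); first by lra.
move=> f Df pf.
pose x k := iter k J f.
have Dx k : D (x k) by case: k => [//|k]; exact: (hJ _).1.
have px k : perp dot s (x k) by elim: k => [//|k IH]; exact: Jperp.
have rc k := resolvent_contraction es A0 d0 erefl gap (Dx k) (px k) (Dx k.+1)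
  (px k.+1) (hJ (x k)).2.
pose Y := nrm dot (x 0%N - x 1%N).
have hx k : nrm dot (x k - x k.+1) <= Y / 2 ^+ k.
  elim: k => [|k IH]; first by rewrite expr0 divr1.
  have := (rc k).2 _ (Dx k.+2) (px k.+2) (hJ (x k.+1)).2.
  rewrite -!nrm_sqr => h.
  have : (2 * nrm dot (x k.+1 - x k.+2)) ^+ 2 <= nrm dot (x k - x k.+1) ^+ 2.
    by rewrite exprMn; lra.
  rewrite ler_sqr ?nnegrE ?mulr_ge0 ?nrm_ge0// => h2.
  rewrite exprS; have p0 : (2 : R) ^+ k != 0 by rewrite expf_neq0.
  have -> : Y / (2 * 2 ^+ k) = (Y / 2 ^+ k) / 2 by field.
  lra.
have [z xz fz] := geometric_cvg hx.
(* A fixed point of [J] satisfies A z = t (z - z) = 0, so the limit lies in the kernel. *)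
have Jz : J z = z.
  by apply: (lipschitz_limit_fixed _ Jlip _ xz) => //; rewrite mulr_ge0 ?ltW.
have [Dz Az] := hJ z; rewrite Jz subrr scaler0 in Dz Az.
have pz : perp dot s z.
  move=> e ein; apply/eqP; rewrite -normr_le0; apply/ler_addgt0Pr => r r0.
  rewrite add0r; have ne := nrm_ge0 dot e.
  have e1 : 0 < r / (nrm dot e + 1) by rewrite divr_gt0// ltr_wpDl.
  have [n /(_ n (leqnn n)) hn] := xz _ e1.
  have -> : dot e z = - dot e (x n - z) by rewrite !ipE (px n e ein); ring.
  rewrite normrN; apply: le_trans (dot_nrm _ _ _) _.
  apply: le_trans (ler_wpM2l ne hn) _.
  rewrite mulrCA; apply: ler_piMr; first exact: ltW.
  by rewrite ler_pdivrMr ?ltr_wpDl// mul1r lerDl.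
have z0 : z = 0 by exact: ker.
move: fz; rewrite z0 subr0 => fz.
(* As [z = 0], the norm of [f] is at most [2 * Y], while 2 t Y^2 <= <A f, f>; this accounts for the
   constant [t / 2]. *)
have := (rc 0%N).1; rewrite -!nrm_sqr -/Y /= => h.
have : nrm dot f ^+ 2 <= (2 * Y) ^+ 2.
  by rewrite ler_sqr ?nnegrE ?nrm_ge0 ?mulr_ge0 ?nrm_ge0.
rewrite exprMn => /(ler_wpM2l (ltW t0)); rewrite /x /= in h *; rewrite /t; lra.
Qed.

(* Neumann series for (A - l')^-1. *)
Lemma regular_open l : regular dot D A l ->
  exists2 d, 0 < d & forall l', `|l' - l| < d -> regular dot D A l'.
Proof.
move=> [surj [C C0 hC]]; exists (2 * C)^-1; first by rewrite invr_gt0 mulr_gt0.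
move=> l' hl.
have small : C * `|l' - l| <= 2^-1.
  have C2 : 0 < 2 * C by rewrite mulr_gt0.
  by move: hl; rewrite -[(2 * C)^-1]mul1r ltr_pdivlMr//; lra.
have shift f : A f - l' *: f = (A f - l *: f) - (l' - l) *: f.
  by rewrite scalerBl opprB addrA subrK.
split=> [g|]; last first.
  exists (2 * C) => [|f Df]; first by rewrite mulr_gt0.
  have := hC f Df.
  have -> : A f - l *: f = (A f - l' *: f) + (l' - l) *: f by rewrite shift subrK.
  move=> h; have := le_trans h (ler_wpM2l (ltW C0) (nrm_triangle _ _ _)).
  rewrite nrmZ mulrDr mulrA.
  have := ler_wpM2r (nrm_ge0 dot f) small; lra.
have [S hS] : {S : V -> V & forall g, D (S g) /\ A (S g) - l *: S g = g}.
  apply: (@choice _ _ (fun g f => D f /\ A f - l *: f = g)) => k.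
  by have [f Df Af] := surj k; exists f.
pose T f := S (g + (l' - l) *: f).
have lip f h : nrm dot (T f - T h) <= 2^-1 * nrm dot (f - h).
  have [Df Af] := hS (g + (l' - l) *: f); have [Dh Ah] := hS (g + (l' - l) *: h).
  apply: le_trans (hC _ (domB linA Df Dh)) _.
  have -> : A (S (g + (l' - l) *: f) - S (g + (l' - l) *: h)) -
      l *: (S (g + (l' - l) *: f) - S (g + (l' - l) *: h)) = (l' - l) *: (f - h).
    rewrite [LHS](opB (linear_on_shift linA l) Df Dh) Af Ah.
    by rewrite opprD addrACA subrr add0r scalerBr.
  by rewrite nrmZ mulrA ler_wpM2r// nrm_ge0.
pose x k := iter k T 0.
have hx k : nrm dot (x k - x k.+1) <= nrm dot (x 0%N - x 1%N) / 2 ^+ k.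
  elim: k => [|k IH]; first by rewrite expr0 divr1.
  apply: le_trans (lip _ _) _; rewrite exprS.
  have p0 : (2 : R) ^+ k != 0 by rewrite expf_neq0.
  have -> : nrm dot (x 0%N - x 1%N) / (2 * 2 ^+ k) =
     2^-1 * (nrm dot (x 0%N - x 1%N) / 2 ^+ k) by field.
  by rewrite ler_pM2l// invr_gt0.
have [z xz _] := geometric_cvg hx.
have Tz : T z = z.
  by apply: (lipschitz_limit_fixed _ lip _ xz) => //; rewrite invr_ge0.
have [Dz Az] := hS (g + (l' - l) *: z); rewrite -/(T z) Tz in Dz Az.
by exists z => //; rewrite shift Az addrK.
Qed.

End KernelGap.

(** * Symmetric operators without essential spectrum *)

Section DiscreteSpectrum.
Variables (R : realType) (V : lmodType R) (dot : inner_product V).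
Variables (D : set V) (A : V -> V).
Hypothesis linA : linear_on D A.
Hypothesis symA : forall f g, D f -> D g -> dot (A f) g = dot f (A g).
Hypothesis complete : complete_ip dot.

Lemma perp_cat s s' f : perp dot (s ++ s') f <-> perp dot s f /\ perp dot s' f.
Proof.
split=> [h|[h h'] e]; last by rewrite mem_cat => /orP[/h|/h'].
by split=> e es; apply: h; rewrite mem_cat es ?orbT.
Qed.

(** The absence of essential spectrum enters as punctured neighbourhoods of regular points and as
    finite sequences of eigenvectors for [l] to which no further nonzero eigenvector for [l] is
    orthogonal. *)
Lemma rayleigh_unbounded : (forall f, D f -> 0 <= dot (A f) f) ->
  (forall l, exists2 d, 0 < d & forall l', 0 < `|l' - l| -> `|l' - l| < d ->
     regular dot D A l') ->
  (forall l, exists2 s, (forall e, e \in s -> D e /\ A e = l *: e) &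
     forall h, D h -> A h = l *: h -> perp dot s h -> h = 0) ->
  forall M, exists2 s, eigenseq D A s &
    forall f, D f /\ perp dot s f -> M * dot f f <= dot (A f) f.
Proof.
move=> A0 disc fin.
pose S := [set M | exists2 s, eigenseq D A s &
    forall f, D f /\ perp dot s f -> M * dot f f <= dot (A f) f].
have down x y : S y -> x <= y -> S x.
  move=> [s es h] xy; exists s => // f /h; apply: le_trans.
  by apply: ler_wpM2r => //; exact: ip_ge0.
have S0 : S 0 by exists [::] => // f [Df _]; rewrite mul0r; exact: A0.
move=> M; have [//|nSM] := pselect (S M); exfalso.
have ub : ubound S M.
  by move=> y Sy; rewrite leNgt; apply/negP => /ltW /(down _ _ Sy).
have hs : has_sup S by split; [exists 0 | exists M].
pose m := sup S.
have [d d0 reg] := disc m.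
have [a Sa am] := sup_adherent d0 hs.
have am' : a <= m by apply: ub_le_sup Sa; exists M.
have [s es hs'] := Sa.
(* The supremum is attained: [a] lies within [d] of [m], so every point of [a, m) is regular and the
   bound [a] rises to [m] for the same [s]. *)
have hm f : D f /\ perp dot s f -> m * dot f f <= dot (A f) f.
  apply: (bottom_gap linA symA es (a := a)) => // l al lm.
  apply: reg; first by rewrite normr_gt0; apply/eqP; lra.
  by rewrite ltr_norml; rewrite -/m in am; lra.
have [k hk kerk] := fin m.
pose B f := A f - m *: f.
have linB : linear_on D B by exact: linear_on_shift.
have symB f g : D f -> D g -> dot (B f) g = dot f (B g).
  by move=> Df Dg; rewrite /B !ipE symA.
have eB e l : A e = l *: e -> B e = (l - m) *: e.
  by move=> Ae; rewrite /B Ae scalerBl.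
have esk : eigenseq D A (s ++ k).
  move=> e; rewrite mem_cat => /orP[/es//|/hk[De Ae]]; split=> //; by exists m.
have esB : eigenseq D B (s ++ k).
  move=> e /esk[De [l /eB Be]]; split=> //; by exists (l - m).
have B0 h : D h -> perp dot (s ++ k) h -> 0 <= dot (B h) h.
  move=> Dh /perp_cat[ph _]; rewrite /B !ipE.
  by have := hm _ (conj Dh ph); lra.
have regB l : 0 < `|l| -> `|l| < d -> regular dot D B l.
  move=> l0 ld; have [] : regular dot D A (l + m) by apply: reg; rewrite addrK.
  move=> surj [C C0 hC].
  have shift f : B f - l *: f = A f - (l + m) *: f.
    by rewrite /B scalerDl opprD addrAC addrA.
  split; first by move=> g; have [f Df fg] := surj g; exists f; rewrite ?shift.
  by exists C => // f Df; rewrite shift; exact: hC.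
have kerB h : D h -> B h = 0 -> perp dot (s ++ k) h -> h = 0.
  move=> Dh /eqP; rewrite subr_eq0 => /eqP Ah /perp_cat[_ ph]; exact: kerk.
(* With the eigenvectors at [m] adjoined to [s], the operator A - m has no kernel left in the
   orthogonal complement, so the bound improves from [m] to [m + c]. *)
have [c c0 hc] := kernel_gap linB symB complete esB B0 d0 regB kerB.
have Sc : S (m + c).
  exists (s ++ k) => // f [Df pf]; have := hc f Df pf; rewrite /B !ipE; lra.
have : m + c <= m by apply: ub_le_sup Sc; exists M.
by lra.
Qed.

(** * Correcting nearly orthogonal test vectors *)

Fixpoint orthonormal (b : seq V) : Prop :=
  if b is e :: b' then [/\ dot e e = 1, perp dot b' e & orthonormal b']
  else True.

Definition proj (b : seq V) h := \sum_(e <- b) dot e h *: e.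

Lemma proj_cons e b h : proj (e :: b) h = dot e h *: e + proj b h.
Proof. by rewrite /proj big_cons. Qed.

Lemma proj_perp_l b e h : perp dot b e -> dot e (proj b h) = 0.
Proof.
elim: b => [|x b IH] pe; first by rewrite /proj big_nil ip0r.
rewrite proj_cons !ipE IH; last by move=> y yb; apply: pe; rewrite inE yb orbT.
by rewrite (ipC _ e x) pe ?inE ?eqxx// mulr0 addr0.
Qed.

Lemma sub_proj_perp b h : orthonormal b -> perp dot b (h - proj b h).
Proof.
elim: b => [|e b IH] //= [e1 pe /IH pb] x; rewrite inE => /orP[/eqP ->|xb].
  by rewrite proj_cons !ipE e1 (proj_perp_l h pe); lra.
rewrite proj_cons opprD addrCA addrA -addrA ipDr pb// addr0.
by rewrite !ipE (ipC _ x e) (ipC _ e x) pe// mulr0 oppr0.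
Qed.

(** Vectors dependent on those already treated are dropped. What the sequel needs is that [b] stays
    in the domain and that orthogonality to [b] implies orthogonality to [s]. *)
Lemma gram_schmidt s : (forall e, e \in s -> D e) ->
  exists b, [/\ forall e, e \in b -> D e, orthonormal b &
    forall f, perp dot b f -> perp dot s f].
Proof.
elim: s => [|e s IH] hs; first by exists [::].
have [b [Db ob pb]] := IH (fun x xs => hs x (@mem_behead _ (e :: s) x xs)).
have De : D e by apply: hs; rewrite inE eqxx.
have Dp : D (proj b e).
  rewrite /proj; elim: b Db {ob pb} => [|x b IHb] Db.
    by rewrite big_nil; exact: (dom0 linA).
  rewrite big_cons; apply: (dom_lin linA); first by apply: Db; rewrite inE eqxx.
  by apply: IHb => y yb; apply: Db; rewrite inE yb orbT.
pose e' := e - proj b e; have pe' : perp dot b e' by exact: sub_proj_perp.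
have De' : D e' by exact: (domB linA).
have pe f : perp dot b f -> dot e f = dot e' f.
  by move=> pf; rewrite /e' !ipE (ipC _ (proj b e)) proj_perp_l// subr0.
have [e0|en0] := eqVneq (dot e' e') 0.
  exists b; split=> // f pf x; rewrite inE => /orP[/eqP ->|]; last exact: pb.
  by rewrite pe// (ip_eq0 e0) ip0l.
pose n := nrm dot e'.
have n0 : n != 0.
  by apply: contra en0 => /eqP n0; rewrite -nrm_sqr -/n n0 expr0n.
exists (n^-1 *: e' :: b); split.
- move=> x; rewrite inE => /orP[/eqP ->|]; last exact: Db.
  exact: (domZ linA).
- split=> //.
    by rewrite !ipZl !ipZr -nrm_sqr -/n; field.
  by move=> x xb; rewrite ipZr pe'// mulr0.
- move=> f pf.
  have pbf : perp dot b f by move=> x xb; apply: pf; rewrite inE xb orbT.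
  move=> x; rewrite inE => /orP[/eqP ->|]; last exact: pb.
  have := pf (n^-1 *: e'); rewrite inE eqxx => /(_ isT) /eqP.
  by rewrite ipZl mulf_eq0 invr_eq0 (negbTE n0) /= pe// => /eqP.
Qed.

(** The projection has finite rank and range in [D], so small coefficients make it small in the
    graph norm of [A], although [A] may be unbounded. *)
Lemma proj_small b : (forall e, e \in b -> D e) -> exists2 C, 0 <= C &
  forall h r, (forall e, e \in b -> `|dot e h| <= r) ->
   [/\ D (proj b h), nrm dot (proj b h) <= C * r &
       nrm dot (A (proj b h)) <= C * r].
Proof.
elim: b => [|e b IH] Db.
  exists 0 => // h r _; rewrite /proj big_nil (op0 linA) nrm0 mul0r.
  by split=> //; exact: (dom0 linA).
have [C C0 hC] := IH (fun x xs => Db x (@mem_behead _ (e :: b) x xs)).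
have De : D e by apply: Db; rewrite inE eqxx.
have n1 := nrm_ge0 dot e; have n2 := nrm_ge0 dot (A e).
exists (nrm dot e + nrm dot (A e) + C); first by lra.
move=> h r hr.
have er : `|dot e h| <= r by apply: hr; rewrite inE eqxx.
have r0 : 0 <= r by apply: le_trans er.
have [Dp p1 p2] := hC h r (fun x xs => hr x (@mem_behead _ (e :: b) x xs)).
rewrite proj_cons; split; first exact: (dom_lin linA).
  apply: le_trans (nrm_triangle _ _ _) _; rewrite nrmZ.
  have := ler_wpM2r n1 er; have := mulr_ge0 n2 r0; lra.
rewrite (op_lin linA)//; apply: le_trans (nrm_triangle _ _ _) _; rewrite nrmZ.
have := ler_wpM2r n2 er; have := mulr_ge0 n1 r0; lra.
Qed.

(** Subtracting its projection makes a nearly orthogonal test vector exactly orthogonal to [s] and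
    changes its Rayleigh quotient by too little to reach [L + 1]. *)
Lemma rayleigh_test (L : R) s : 0 <= L -> (forall e, e \in s -> D e) ->
  (forall f, D f /\ perp dot s f -> (L + 1) * dot f f <= dot (A f) f) ->
  (forall (s' : seq V) e, 0 < e -> exists h, [/\ D h, h != 0,
     dot (A h) h <= L * dot h h &
     forall x, x \in s' -> `|dot x h| <= e * nrm dot h]) -> False.
Proof.
move=> L0 Ds hs test.
have [b [Db ob pb]] := gram_schmidt Ds.
have [C C0 hC] := proj_small Db.
(* Chosen so that [(L + 1) * (1 - 2 * r)] exceeds [L + 2 * r + r ^+ 2], the two sides compared in
   the end. *)
pose r := (4 * (L + 2))^-1.
have r0 : 0 < r by rewrite invr_gt0; lra.
have [h [Dh hn0 hL he]] := test b (r / (C + 1)) ltac:(rewrite divr_gt0//; lra).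
have [Dp p1 p2] := hC h _ he.
pose n := nrm dot h.
have n0 : 0 < n.
  rewrite lt_neqAle nrm_ge0 andbT eq_sym.
  by apply: contra hn0 => /eqP /nrm0_eq0 ->.
have Cr : C * (r / (C + 1) * nrm dot h) <= r * n.
  rewrite mulrA ler_pM2r// mulrCA; apply: ler_piMr; first exact: ltW.
  by rewrite ler_pdivrMr; lra.
have {}p1 := le_trans p1 Cr; have {}p2 := le_trans p2 Cr.
set p := proj b h in Dp p1 p2.
have pf : perp dot s (h - p) by apply: pb; exact: sub_proj_perp.
have := hs _ (conj (domB linA Dh Dp) pf).
rewrite (opB linA)// !ipE (ipC _ p h) (symA Dh Dp) (ipC _ (A p) h).
move: hL; rewrite -!nrm_sqr -/n.
have := le_trans (ler_norm _) (le_trans (dot_nrm dot h p) (ler_wpM2l (ltW n0) p1)).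
have := dot_nrm dot h (A p); rewrite ler_norml => /andP[+ _].
have := ler_wpM2l (ltW n0) p2; rewrite -/n.
have := le_trans (ler_norm _) (le_trans (dot_nrm dot (A p) p)
   (ler_pM (nrm_ge0 _ _) (nrm_ge0 _ _) p2 p1)).
have := sqr_ge0 (nrm dot p).
move: (dot (A p) p) (dot h (A p)) (dot h p) (dot (A h) h) (nrm dot p ^+ 2)
  (nrm dot (A p)) => x y z w u v u0 h1 h2 h3 h4 h5 h6.
have n2 : 0 < n ^+ 2 by rewrite exprn_gt0.
have r1 : r * (L + 2) = 4^-1 by rewrite /r; field; lra.
have r2 : r <= 4^-1.
  by rewrite -r1; apply: ler_peMr; lra.
have h7 : (L + 1) * (1 - 2 * r) * n ^+ 2 <= (L + 2 * r + r ^+ 2) * n ^+ 2.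
  have : (L + 1) * (n ^+ 2 - 2 * (r * n ^+ 2)) <= (L + 1) * (n ^+ 2 - z - (z - u)).
    by apply: ler_wpM2l; lra.
  lra.
move: h7; rewrite ler_pM2r//.
have : r ^+ 2 <= r * 4^-1 by rewrite expr2 ler_wpM2l// ltW.
lra.
Qed.

End DiscreteSpectrum.

(** * Operators with a core *)

Section Density.
Variables (R : realType) (V : lmodType R) (dot : inner_product V).
Hypothesis complete : complete_ip dot.

Lemma harmonic_small (e : R) : 0 < e -> exists n : nat, n.+1%:R^-1 <= e.
Proof.
move=> e0; exists (Num.bound e^-1).
rewrite -[leRHS]invrK lef_pV2 ?posrE ?invr_gt0// ltW//.
apply: (lt_le_trans (archi_boundP _)); first by rewrite invr_ge0 ltW.
by rewrite ler_nat leqnSn.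
Qed.

Lemma orthogonal_of_min w z :
  (forall u, dot w w <= dot (w + u *: z) (w + u *: z)) -> dot w z = 0.
Proof.
move=> key; have : dot w z ^+ 2 <= dot z z * 0.
  apply: discr_le => [|u]; first exact: ip_ge0.
  by move: (key u); rewrite !ipE (ipC dot z w); lra.
by rewrite mulr0 => h; apply/eqP; rewrite -sqrf_eq0 eq_le h sqr_ge0.
Qed.

(** The projection theorem for a subspace that need not be closed: a minimizing sequence is Cauchy,
    and [g] minus its limit is orthogonal to [Y], hence zero. *)
Lemma dense_of_orthogonal0 (Y : set V) : Y 0 ->
  (forall c f g, Y f -> Y g -> Y (c *: f + g)) ->
  (forall g, (forall y, Y y -> dot g y = 0) -> g = 0) ->
  forall g e, 0 < e -> exists2 y, Y y & nrm dot (g - y) <= e.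
Proof.
move=> Y0 Ylin Yperp g e e0.
pose S := [set dot (g - y) (g - y) | y in Y].
have lbS : has_inf S.
  split; first by exists (dot (g - 0) (g - 0)), 0.
  by exists 0 => _ [y _ <-]; exact: ip_ge0.
pose d := inf S.
have dmin y : Y y -> d <= dot (g - y) (g - y).
  by move=> Yy; apply: ge_inf; [exact: lbS.2 | exists y].
have [y hy] : {y : nat -> V & forall n, Y (y n) /\
    dot (g - y n) (g - y n) <= d + n.+1%:R^-1}.
  apply: (@choice _ _ (fun n y => Y y /\ dot (g - y) (g - y) <= d + n.+1%:R^-1)).
  move=> n; have n0 : 0 < (n.+1%:R : R)^-1 by rewrite invr_gt0.
  have [_ [y Yy <-] /ltW h] := inf_adherent n0 lbS; by exists y.
have inv_le n i : (n <= i)%N -> (i.+1%:R : R)^-1 <= n.+1%:R^-1.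
  by move=> ni; rewrite lef_pV2 ?posrE// ler_nat ltnS.
have cy : nrm_cauchy dot y.
  move=> r r0.
  have [n hn] := harmonic_small (divr_gt0 (exprn_gt0 2 r0) (ltr0n R 4)).
  exists n => i j ni nj.
  rewrite -ler_sqr ?nnegrE ?nrm_ge0 ?(ltW r0)// nrm_sqr.
  have [Yi hi] := hy i; have [Yj hj] := hy j.
  (* The midpoint of [y i] and [y j] is a competitor in the minimization; the parallelogram identity
     then bounds the distance between the two. *)
  have Ym : Y (2^-1 *: y i + (2^-1 *: y j + 0)).
    exact: (Ylin _ _ _ (hy i).1 (Ylin _ _ _ (hy j).1 Y0)).
  have := dmin _ Ym; have := inv_le _ _ ni; have := inv_le _ _ nj.
  move: hi hj; rewrite addr0 !ipE.
  rewrite (ipC dot (y i) g) (ipC dot (y j) g) (ipC dot (y j) (y i)); move: hn.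
  move: (i.+1%:R^-1 : R) (j.+1%:R^-1 : R) (n.+1%:R^-1 : R) (r ^+ 2) => ? ? ? ?.
  lra.
have [p yp] := complete cy.
have wy z : Y z -> dot (g - p) z = 0.
  move=> Yz; pose w := g - p.
  have near : forall t, 0 < t -> exists n,
     nrm dot (g - y n - w) <= t /\ n.+1%:R^-1 <= t.
    move=> t t0; have [n1 h1] := yp _ t0; have [n2 h2] := harmonic_small t0.
    exists (maxn n1 n2); split; last first.
      by apply: le_trans h2; apply: inv_le; exact: leq_maxr.
    have := h1 _ (leq_maxl n1 n2); rewrite -nrmN; congr (nrm _ _ <= _).
    by rewrite /w !opprB [RHS]addrC addrA subrK.
  (* The limit [p] is only approximated by [Y], so the minimality of [w = g - p] is obtained up to
     [r] by comparing with [y n]. The constant [K] adds the two errors from [dot_approx] and the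
     defect of [y n] as a minimizer. *)
  have key u : dot w w <= dot (w + u *: z) (w + u *: z).
    apply/ler_addgt0Pr => r r0.
    pose K := 2 * nrm dot w + 2 * nrm dot (w + u *: z) + 3.
    have K3 : 3 <= K.
      by rewrite /K; have := nrm_ge0 dot w; have := nrm_ge0 dot (w + u *: z); lra.
    pose t := Num.min 1 (r / K).
    have t0 : 0 < t by rewrite lt_min ltr01 divr_gt0//; lra.
    have t1 : t <= 1 by rewrite ge_min lexx.
    have tK : t * K <= r.
      by rewrite -ler_pdivlMr; [rewrite ge_min lexx orbT | lra].
    have [n [n1 n2]] := near t t0.
    have [Yn hn] := hy n.
    have Yu : Y ((- u) *: z + y n) by exact: Ylin.
    have := dmin _ Yu.
    have h1 := dot_approx (f' := g - y n) (g' := g - y n) (f := w) (g := w)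
      (eq_ind_r (fun r => r <= _) n1 (nrm_distC _ _ _))
      (eq_ind_r (fun r => r <= _) n1 (nrm_distC _ _ _)) t1.
    have e1 : w + u *: z - (g - (- u *: z + y n)) = w - (g - y n).
      by rewrite scaleNr !opprB -addrA -[- (u *: z) + _ + _]addrA addNKr.
    have n1' : nrm dot (w + u *: z - (g - (- u *: z + y n))) <= t.
      by rewrite e1 nrm_distC.
    have h2 := dot_approx n1' n1' t1.
    move: h1 h2; rewrite !ler_norml => /andP[h1 h1'] /andP[h2 h2'] h3.
    have := tK; rewrite /K; move: hn n2; move: (n.+1%:R^-1 : R) => q; lra.
  exact: orthogonal_of_min key.
have gp : g = p by apply/eqP; rewrite -subr_eq0; apply/eqP; exact: Yperp.
have [n /(_ n (leqnn n)) hn] := yp _ e0.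
by exists (y n); [exact: (hy n).1 | rewrite gp nrm_distC].
Qed.

Variables (D C : set V) (A : V -> V).
Hypothesis linD : linear_on D A.
Hypothesis CD : C `<=` D.
Hypothesis C0 : C 0.
Hypothesis Clin : forall c f g, C f -> C g -> C (c *: f + g).
Hypothesis symC : forall f g, C f -> C g -> dot (A f) g = dot f (A g).
Hypothesis posC : forall f, C f -> 0 <= dot (A f) f.
Hypothesis closedA : forall u l w, (forall i : nat, D (u i)) ->
  nrm_cvg dot u l -> nrm_cvg dot (A \o u) w -> D l /\ A l = w.
Hypothesis adjA : forall g, (forall k, C k -> dot g (A k + k) = 0) ->
  D g /\ A g = - g.
Hypothesis injA : forall f, D f -> A f = - f -> f = 0.

(** The range of A + 1 on [C] is dense, by [adjA] and [injA]. Approximate A f + f by A h + h with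
    [h] in [C]: positivity makes |A k + k| dominate both |k| and |A k| on [C], so the [h] converge
    in the graph norm. By closedness the limit solves the same equation as [f], and injectivity
    identifies the two. *)
Lemma core_approx f e : D f -> 0 < e -> exists h,
  [/\ C h, nrm dot (f - h) <= e & nrm dot (A f - A h) <= e].
Proof.
move=> Df e0.
pose Y := [set A k + k | k in C].
have Y0 : Y 0 by exists 0 => //; rewrite (op0 linD) addr0.
have Ylin c u v : Y u -> Y v -> Y (c *: u + v).
  move=> [k Ck <-] [k' Ck' <-]; exists (c *: k + k'); first exact: Clin.
  by rewrite (op_lin linD c (CD Ck) (CD Ck')) scalerDr addrACA.
have Yperp g : (forall y, Y y -> dot g y = 0) -> g = 0.
  move=> h; have [Dg Ag] : D g /\ A g = - g; last exact: injA.
    by apply: adjA => k Ck; apply: h; exists k.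
have dense := dense_of_orthogonal0 Y0 Ylin Yperp.
pose g := A f + f.
have [h hh] : {h : nat -> V & forall n, C (h n) /\
    nrm dot (g - (A (h n) + h n)) <= n.+1%:R^-1}.
  apply: (@choice _ _ (fun n h => C h /\ nrm dot (g - (A h + h)) <= n.+1%:R^-1)).
  move=> n; have n0 : 0 < (n.+1%:R : R)^-1 by rewrite invr_gt0.
  by have [_ [k Ck <-] hk] := dense g _ n0; exists k.
have bound k : C k -> nrm dot k <= nrm dot (A k + k) /\
    nrm dot (A k) <= nrm dot (A k + k).
  move=> Ck; rewrite -!(ler_sqr (nrm_ge0 _ _) (nrm_ge0 _ _)) !nrm_sqr !ipE.
  have := posC Ck; have := ip_ge0 dot k; have := ip_ge0 dot (A k).
  by rewrite (ipC dot k (A k)); split; lra.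
have inv_le n i : (n <= i)%N -> (i.+1%:R : R)^-1 <= n.+1%:R^-1.
  by move=> ni; rewrite lef_pV2 ?posrE// ler_nat ltnS.
have CB i j : C (h i - h j).
  by rewrite addrC -scaleN1r; apply: Clin; [exact: (hh j).1|exact: (hh i).1].
have cauchy r : 0 < r -> exists n, forall i j, (n <= i)%N -> (n <= j)%N ->
    nrm dot (A (h i - h j) + (h i - h j)) <= r.
  move=> r0; have [n hn] := harmonic_small (divr_gt0 r0 (ltr0n R 2)).
  exists n => i j ni nj.
  have [[Ci hi] [Cj hj]] := (hh i, hh j).
  rewrite (opB linD (CD Ci) (CD Cj)).
  have -> : A (h i) - A (h j) + (h i - h j) =
     (A (h i) + h i - g) + (g - (A (h j) + h j)).
    by rewrite [RHS]addrA subrK opprD addrACA.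
  apply: le_trans (nrm_triangle _ _ _) _; rewrite nrm_distC.
  have := le_trans hi (le_trans (inv_le _ _ ni) hn).
  have := le_trans hj (le_trans (inv_le _ _ nj) hn); lra.
have c1 : nrm_cauchy dot h.
  move=> r /cauchy[n hn]; exists n => i j ni nj.
  exact: le_trans (bound _ (CB i j)).1 (hn i j ni nj).
have c2 : nrm_cauchy dot (A \o h).
  move=> r /cauchy[n hn]; exists n => i j ni nj /=.
  rewrite -(opB linD (CD (hh i).1) (CD (hh j).1)).
  exact: le_trans (bound _ (CB i j)).2 (hn i j ni nj).
have [l hl] := complete c1; have [w hw] := complete c2.
have Dh i : D (h i) by apply: CD; exact: (hh i).1.
have [Dl Al] := closedA Dh hl hw.
have wl : w + l = g.
  apply/eqP; rewrite -subr_eq0; apply/eqP; apply: (@nrm0_eq0 _ _ dot).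
  apply/eqP; rewrite eq_le nrm_ge0 andbT; apply/ler_addgt0Pr => r r0.
  rewrite add0r; have r3 : 0 < r / 3 by rewrite divr_gt0.
  have [n1 h1] := hl _ r3; have [n2 h2] := hw _ r3.
  have [n3 h3] := harmonic_small r3.
  pose n := maxn n1 (maxn n2 n3).
  have {}h1 := h1 n (leq_maxl _ _).
  have {}h2 := h2 n (leq_trans (leq_maxl _ _) (leq_maxr _ _)).
  have {}h3 : nrm dot (g - (A (h n) + h n)) <= r / 3.
    apply: le_trans (hh n).2 (le_trans (inv_le n3 n _) h3).
    exact: leq_trans (leq_maxr _ _) (leq_maxr _ _).
  have -> : w + l - g = - (A (h n) - w) + - (h n - l) + - (g - (A (h n) + h n)).
    by rewrite !opprB (addrACA w) -opprD [RHS]addrA subrK.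
  apply: le_trans (nrm_triangle _ _ _) _; rewrite nrmN.
  have := nrm_triangle dot (- (A (h n) - w)) (- (h n - l)); rewrite !nrmN /= in h2 *.
  lra.
have fl : f - l = 0.
  apply: injA; first exact: (domB linD).
  rewrite (opB linD)// opprB Al; apply/eqP.
  by rewrite subr_eq addrAC eq_sym subr_eq [l + w]addrC wl.
have {}fl : f = l by apply/eqP; rewrite -subr_eq0 fl.
have [n1 h1] := hl _ e0; have [n2 h2] := hw _ e0.
exists (h (maxn n1 n2)); split; first exact: (hh _).1.
  by rewrite fl nrm_distC; apply: h1; exact: leq_maxl.
by rewrite fl Al nrm_distC; apply: h2; exact: leq_maxr.
Qed.

Lemma core_dot f g r : D f -> D g -> 0 < r -> exists2 t, 0 < t &
  forall h k, nrm dot (f - h) <= t -> nrm dot (A f - A h) <= t ->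
     nrm dot (g - k) <= t -> nrm dot (A g - A k) <= t ->
  `|dot (A f) g - dot (A h) k| <= r /\ `|dot f (A g) - dot h (A k)| <= r.
Proof.
move=> Df Dg r0.
pose K := nrm dot f + nrm dot g + nrm dot (A f) + nrm dot (A g) + 1.
have [n1 n2 n3 n4] : [/\ 0 <= nrm dot f, 0 <= nrm dot g, 0 <= nrm dot (A f) &
    0 <= nrm dot (A g)] by split; exact: nrm_ge0.
have K1 : 1 <= K by rewrite /K; lra.
pose t := Num.min 1 (r / K).
have t0 : 0 < t by rewrite lt_min ltr01 divr_gt0//; lra.
have t1 : t <= 1 by rewrite ge_min lexx.
have tK : t * K <= r.
  by rewrite -ler_pdivlMr; [rewrite ge_min lexx orbT | lra].
exists t => // h k h1 h2 k1 k2; split.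
  apply: le_trans (dot_approx h2 k1 t1) _; apply: le_trans tK.
  by rewrite ler_pM2l// /K; lra.
apply: le_trans (dot_approx h1 k2 t1) _; apply: le_trans tK.
by rewrite ler_pM2l// /K; lra.
Qed.

Lemma core_sym f g : D f -> D g -> dot (A f) g = dot f (A g).
Proof.
move=> Df Dg; apply/eqP; rewrite -subr_eq0 -normr_le0.
apply/ler_addgt0Pr => r r0; rewrite add0r.
have [t t0 ht] := core_dot Df Dg (divr_gt0 r0 (ltr0n R 2)).
have [h [Ch h1 h2]] := core_approx Df t0.
have [k [Ck k1 k2]] := core_approx Dg t0.
have := ht h k h1 h2 k1 k2; rewrite (symC Ch Ck) !ler_norml.
by case=> /andP[? ?] /andP[? ?]; apply/andP; split; lra.
Qed.

Lemma core_ge0 f : D f -> 0 <= dot (A f) f.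
Proof.
move=> Df; apply/ler_addgt0Pr => r r0.
have [t t0 ht] := core_dot Df Df r0.
have [h [Ch h1 h2]] := core_approx Df t0.
have := ht h h h1 h2 h1 h2; rewrite !ler_norml => -[/andP[+ _] _].
by have := posC Ch; lra.
Qed.

End Density.

(** * Sums over a countable type *)

Section RealEsum.
Variables (R : realType) (T : choiceType).
Implicit Types (p q u v : T -> R) (A B : {fset T}) (U : set T).

Lemma fsum_fset_set p U : finite_set U ->
  (\sum_(x \in U) (p x)%:E)%E = (\sum_(x <- fset_set U) p x)%:E.
Proof. by move=> finU; rewrite fsumEFin// fsbig_finite. Qed.

Lemma fsum_le_esum p U A : (forall x, x \in A -> U x) ->
  ((\sum_(x <- A) p x)%:E <= \esum_(x in U) (p x)%:E)%E.
Proof.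
move=> AU; apply: esum_ge; exists [set` A]; first by split; [exact: finite_fset|].
by rewrite fsum_fset_set ?set_fsetK//; exact: finite_fset.
Qed.

Lemma esum_le_bound p U (c : R) :
  (forall A, (forall x, x \in A -> U x) -> \sum_(x <- A) p x <= c) ->
  (\esum_(x in U) (p x)%:E <= c%:E)%E.
Proof.
move=> h; apply: ge_ereal_sup => _ [X [finX XU] <-].
rewrite fsum_fset_set// lee_fin; apply: h => x; rewrite in_fset_set// inE.
exact: XU.
Qed.

Lemma fsum_supp p A B : (A `<=` B)%fset ->
  \sum_(x <- A) p x = \sum_(x <- B) (if x \in A then p x else 0).
Proof.
move=> AB; rewrite -(big_fset_incl _ AB) => [|x _ /negPf ->//].
by apply: eq_big_seq => x ->.
Qed.

Lemma ler_fsum_subset p A B : (forall x, 0 <= p x) -> (A `<=` B)%fset ->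
  \sum_(x <- A) p x <= \sum_(x <- B) p x.
Proof.
move=> p0 AB; rewrite (fsum_supp _ AB); apply: ler_sum => x _.
by case: ifP.
Qed.

(** [fine] sends an infinite sum to 0, so the value is meaningful under [nnsummable] only. *)
Definition nnsum p : R := fine (\esum_(x in setT) (p x)%:E)%E.

Definition nnsummable p := (forall x, 0 <= p x) /\
  (\esum_(x in setT) (p x)%:E < +oo)%E.

Lemma nnsummable_fin p : nnsummable p ->
  (\esum_(x in setT) (p x)%:E)%E = (nnsum p)%:E.
Proof.
move=> [p0 ps]; rewrite /nnsum fineK// ge0_fin_numE//.
by apply: esum_ge0 => x _; rewrite lee_fin.
Qed.

Lemma nnsum_ge p A : nnsummable p -> \sum_(x <- A) p x <= nnsum p.
Proof. by move=> ps; rewrite -lee_fin -nnsummable_fin//; exact: fsum_le_esum. Qed.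

Lemma nnsum_ge1 p x : nnsummable p -> p x <= nnsum p.
Proof.
by move=> /(nnsum_ge [fset x]%fset); rewrite big_seq_fset1.
Qed.

Lemma nnsum_ge0 p : nnsummable p -> 0 <= nnsum p.
Proof. by move=> /(nnsum_ge fset0); rewrite big_seq_fset0. Qed.

Lemma nnsummable_le p c : (forall x, 0 <= p x) ->
  (forall A, \sum_(x <- A) p x <= c) -> nnsummable p /\ nnsum p <= c.
Proof.
move=> p0 h.
have h' : (\esum_(x in setT) (p x)%:E <= c%:E)%E by exact: esum_le_bound.
have ps : nnsummable p by split=> //; apply: le_lt_trans h' (ltry _).
by split=> //; rewrite -lee_fin -nnsummable_fin.
Qed.

Lemma nnsummable_dom p q : (forall x, 0 <= p x) -> (forall x, p x <= q x) ->
  nnsummable q -> nnsummable p /\ nnsum p <= nnsum q.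
Proof.
move=> p0 pq qs; apply: nnsummable_le => // A.
by apply: le_trans (nnsum_ge A qs); apply: ler_sum.
Qed.

Lemma nnsummableD p q : nnsummable p -> nnsummable q ->
  nnsummable (p \+ q) /\ nnsum (p \+ q) = nnsum p + nnsum q.
Proof.
move=> ps qs; have [p0 _] := ps; have [q0 _] := qs.
have e : (\esum_(x in setT) ((p \+ q) x)%:E = (nnsum p + nnsum q)%:E)%E.
  rewrite EFinD -!nnsummable_fin// -esumD// => x _; by rewrite lee_fin.
split; last by rewrite {1}/nnsum e.
by split=> [x|]; [rewrite addr_ge0 | rewrite e ltry].
Qed.

(** One inequality holds for every nonnegative factor; the reverse one is the same inequality for
    [c^-1]. *)
Lemma nnsummableZ c p : 0 <= c -> nnsummable p ->
  nnsummable (fun x => c * p x) /\ nnsum (fun x => c * p x) = c * nnsum p.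
Proof.
move=> c0 ps; have [p0 _] := ps.
have up k q : 0 <= k -> nnsummable q ->
    nnsummable (fun x => k * q x) /\ nnsum (fun x => k * q x) <= k * nnsum q.
  move=> k0 qs; apply: nnsummable_le => [x|A]; first by rewrite mulr_ge0//; exact: qs.1.
  by rewrite -mulr_sumr ler_wpM2l// nnsum_ge.
have [s h] := up c p c0 ps; split=> //.
apply/eqP; rewrite eq_le h /=.
have [->|cn0] := eqVneq c 0; first by
  rewrite mul0r; apply: nnsum_ge0; exact: (up 0 p _ ps).1.
have cp : 0 < c by rewrite lt_neqAle eq_sym cn0.
rewrite -ler_pdivlMl//.
have [_] := up c^-1 _ (ltW (eq_ind_r _ cp (invr_gt0 c))) s.
by congr (nnsum _ <= _); apply/funext => x; rewrite mulKf.
Qed.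

Lemma nnsum_fset p A : (forall x, 0 <= p x) -> (forall x, x \notin A -> p x = 0) ->
  nnsummable p /\ nnsum p = \sum_(x <- A) p x.
Proof.
move=> p0 pA.
have h B : \sum_(x <- B) p x <= \sum_(x <- A) p x.
  rewrite [leRHS](big_fset_incl _ (fsubsetUl A B)) => [|x _]; last exact: pA.
  by apply: ler_fsum_subset => //; exact: fsubsetUr.
have [s le] := nnsummable_le p0 h; split=> //.
by apply/eqP; rewrite eq_le le nnsum_ge.
Qed.

(** The sum of a signed family, from one particular decomposition into a difference of nonnegative
    families; [isum_diff] shows that other summable decompositions give the same value. *)
Definition isum u : R := nnsum (fun x => `|u x| + u x) - nnsum (fun x => `|u x|).

Definition asummable u := nnsummable (fun x => `|u x|).

(** Additivity of [nnsum] is applied to the crosswise identity (|p - q| + (p - q)) + q = |p - q| +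
    p. *)
Lemma isum_diff p q : nnsummable p -> nnsummable q ->
  isum (fun x => p x - q x) = nnsum p - nnsum q.
Proof.
move=> ps qs; have [p0 _] := ps; have [q0 _] := qs.
have [sD eD] := nnsummableD ps qs.
have le1 x : `|p x - q x| <= (p \+ q) x.
  by apply: le_trans (ler_normB _ _) _; rewrite !ger0_norm.
have [s1 _] := nnsummable_dom (fun x => normr_ge0 (p x - q x)) le1 sD.
have [s2 _] : nnsummable (fun x => `|p x - q x| + (p x - q x)) /\
    nnsum (fun x => `|p x - q x| + (p x - q x)) <= nnsum ((p \+ q) \+ (p \+ q)).
  apply: nnsummable_dom (nnsummableD sD sD).1 => x /=.
    by have := ler_norm (- (p x - q x)); rewrite normrN; lra.
  have := le1 x; have := p0 x; have := q0 x; rewrite /=; lra.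
have e : (fun x => `|p x - q x| + (p x - q x)) \+ q = (fun x => `|p x - q x|) \+ p.
  by apply/funext => x /=; ring.
have := (nnsummableD s2 qs).2; rewrite e (nnsummableD s1 ps).2 /isum; lra.
Qed.

Lemma asummable_split u : asummable u -> exists p q,
  [/\ nnsummable p, nnsummable q & u = fun x => p x - q x].
Proof.
move=> s; exists (fun x => `|u x| + u x), (fun x => `|u x|); split=> //; last first.
  by apply/funext => x; ring.
apply: (nnsummable_dom _ _ (nnsummableD s s).1).1 => x /=.
  have := ler_norm (- u x); rewrite normrN; lra.
have := ler_norm (u x); lra.
Qed.

Lemma isum_nn p : nnsummable p -> isum p = nnsum p.
Proof.
move=> ps; have [z z0] : nnsummable (fun _ : T => 0 : R) /\ nnsum (fun _ => 0) = 0.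
  by have := @nnsum_fset (fun _ => 0) fset0; rewrite big_seq_fset0; apply.
have := isum_diff ps z; rewrite z0 subr0 => <-; congr isum.
by apply/funext => x; rewrite subr0.
Qed.

Lemma isumD u v : asummable u -> asummable v ->
  isum (fun x => u x + v x) = isum u + isum v.
Proof.
move=> /asummable_split[p [q [ps qs ->]]] /asummable_split[p' [q' [ps' qs' ->]]].
rewrite !isum_diff//.
have -> : (fun x => p x - q x + (p' x - q' x)) = (fun x => (p \+ p') x - (q \+ q') x).
  by apply/funext => x /=; ring.
rewrite isum_diff; [|exact: (nnsummableD _ _).1..].
by rewrite (nnsummableD ps ps').2 (nnsummableD qs qs').2; ring.
Qed.

Lemma isumZ c u : asummable u -> isum (fun x => c * u x) = c * isum u.
Proof.
move=> /asummable_split[p [q [ps qs ->]]]; rewrite isum_diff//.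
have [c0|c0] := leP 0 c.
  have [s1 e1] := nnsummableZ c0 ps; have [s2 e2] := nnsummableZ c0 qs.
  rewrite mulrBr -e1 -e2 -isum_diff//; congr isum.
  by apply/funext => x; rewrite mulrBr.
have c0' : 0 <= - c by lra.
have [s1 e1] := nnsummableZ c0' ps; have [s2 e2] := nnsummableZ c0' qs.
have -> : c * (nnsum p - nnsum q) = (- c) * nnsum q - (- c) * nnsum p by ring.
rewrite -e1 -e2 -isum_diff//; congr isum.
by apply/funext => x; ring.
Qed.

Lemma isum_fset u A : (forall x, x \notin A -> u x = 0) ->
  isum u = \sum_(x <- A) u x.
Proof.
move=> uA; rewrite /isum.
rewrite (@nnsum_fset (fun x => `|u x| + u x) A _ _).2; last 2 first.
- by move=> x; have := ler_norm (- u x); rewrite normrN; lra.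
- by move=> x /uA ->; rewrite normr0 addr0.
rewrite (@nnsum_fset (fun x => `|u x|) A _ _).2 => [|//|x /uA ->]; last first.
  by rewrite normr0.
by rewrite -sumrB; apply: eq_bigr => x _; rewrite addrC addrA addrN add0r || ring.
Qed.

End RealEsum.

(** * The Hilbert space L2 *)

Lemma real_cauchy (R : realType) (a : nat -> R) :
  (forall e, 0 < e -> exists n, forall i j, (n <= i)%N -> (n <= j)%N ->
     `|a i - a j| <= e) -> exists l : R, a @ \oo --> l.
Proof.
move=> h; suff : cvgn a by move=> c; exists (limn a).
apply: cauchy_cvg; apply: cauchy_exP => e e0.
have [n hn] := h (e / 2) ltac:(by rewrite divr_gt0).
exists (a n); exists n => // i /= ni.
by rewrite /ball /=; apply: le_lt_trans (hn _ _ (leqnn n) ni) _; lra.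
Qed.

Section L2Space.
Variables (R : realType) (G : countType) (theta : G -> R).

(** Taking the positivity of [theta] as an argument lets the submodule structure, whose proof relies
    on it, be attached to the predicate and to the type [l2]. *)
Definition l2pred of (forall x, 0 < theta x) : {pred G -> R} :=
  fun f => `[< L2 theta f >].

Variable theta_gt0 : forall x, 0 < theta x.

Lemma L2P f : L2 theta f <-> nnsummable (fun x => f x ^+ 2 * theta x).
Proof.
split=> [h|[_ //]]; split=> // x.
by rewrite mulr_ge0 ?sqr_ge0// ltW.
Qed.

Lemma L2D f g : L2 theta f -> L2 theta g -> L2 theta (f + g).
Proof.
move=> /L2P hf /L2P hg; apply/L2P.
have [s _] := nnsummableZ (ler0n R 2) (nnsummableD hf hg).1.
apply: (nnsummable_dom _ _ s).1 => x.
  by rewrite mulr_ge0 ?sqr_ge0// ltW.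
rewrite /= -mulrDl mulrA ler_wpM2r ?(ltW (theta_gt0 x))//.
by have := sqr_ge0 (f x - g x); have -> : (f + g) x = f x + g x by []; lra.
Qed.

Lemma L2Z c f : L2 theta f -> L2 theta (c *: f).
Proof.
move=> /L2P hf; apply/L2P.
have [s _] := nnsummableZ (sqr_ge0 c) hf.
apply: (nnsummable_dom _ _ s).1 => x; first by rewrite mulr_ge0 ?sqr_ge0// ltW.
have -> : (c *: f) x = c * f x by [].
by rewrite exprMn -mulrA.
Qed.

Lemma L2_finite (A : {fset G}) f : (forall x, x \notin A -> f x = 0) -> L2 theta f.
Proof.
move=> fA; apply/L2P; apply: (@nnsum_fset _ _ _ A _ _).1 => [x|x /fA ->].
  by rewrite mulr_ge0 ?sqr_ge0// ltW.
by rewrite expr0n mul0r.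
Qed.

Lemma l2pred_closed : submod_closed (l2pred theta_gt0).
Proof.
split; first by apply/asboolP; apply: (@L2_finite fset0).
move=> c f g /asboolP hf /asboolP hg; apply/asboolP.
by apply: L2D => //; exact: L2Z.
Qed.

HB.instance Definition _ :=
  GRing.isSubmodClosed.Build R (G -> R) (l2pred theta_gt0) l2pred_closed.

Record l2 := L2Fun { l2val :> G -> R; l2valP : l2val \in l2pred theta_gt0 }.

HB.instance Definition _ := [isSub for l2val].
HB.instance Definition _ := [Choice of l2 by <:].
HB.instance Definition _ := [SubChoice_isSubLmodule of l2 by <:].

Definition mkl2 f (h : L2 theta f) : l2 := L2Fun (asboolT h : f \in l2pred theta_gt0).

Implicit Types f g h : l2.

Lemma l2_L2 f : L2 theta f.
Proof. by have /asboolP := l2valP f. Qed.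

Lemma l2DE f g x : (f + g) x = f x + g x. Proof. by []. Qed.
Lemma l2ZE c f x : (c *: f) x = c * f x. Proof. by []. Qed.
Lemma l2NE f x : (- f) x = - f x. Proof. by []. Qed.
Lemma l20E x : (0 : l2) x = 0. Proof. by []. Qed.

Definition dot_fun f g := isum (fun x => f x * g x * theta x).

Lemma dot_summable f g : asummable (fun x => f x * g x * theta x).
Proof.
have /L2P hf := l2_L2 f; have /L2P hg := l2_L2 g.
apply: (nnsummable_dom _ _ (nnsummableD hf hg).1).1 => x //=.
have t0 := theta_gt0 x.
rewrite normrM (gtr0_norm t0) -mulrDl ler_wpM2r ?(ltW t0)// ler_norml.
have := sqr_ge0 (f x - g x); have := sqr_ge0 (f x + g x).
have := sqr_ge0 (f x); have := sqr_ge0 (g x).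
by move=> ? ? ? ?; apply/andP; split; lra.
Qed.

Lemma dot_funC f g : dot_fun f g = dot_fun g f.
Proof. by congr isum; apply/funext => x; rewrite (mulrC (f x)). Qed.

Lemma dot_funDl f g h : dot_fun (f + g) h = dot_fun f h + dot_fun g h.
Proof.
rewrite /dot_fun -isumD; [|exact: dot_summable..].
by congr isum; apply/funext => x; rewrite l2DE; ring.
Qed.

Lemma dot_funZl c f g : dot_fun (c *: f) g = c * dot_fun f g.
Proof.
rewrite /dot_fun -isumZ; last exact: dot_summable.
by congr isum; apply/funext => x; rewrite l2ZE; ring.
Qed.

Lemma dot_fun_sqr f : dot_fun f f = nnsum (fun x => f x ^+ 2 * theta x).
Proof.
by have /L2P hf := l2_L2 f; rewrite -isum_nn.
Qed.

Lemma dot_fun_ge0 f : 0 <= dot_fun f f.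
Proof. by rewrite dot_fun_sqr; apply: nnsum_ge0; apply/L2P/l2_L2. Qed.

Lemma sqr_le_dot f x : f x ^+ 2 * theta x <= dot_fun f f.
Proof.
rewrite dot_fun_sqr; apply: (@nnsum_ge1 R G (fun x => f x ^+ 2 * theta x)).
by apply/L2P/l2_L2.
Qed.

Lemma dot_fun_eq0 f : dot_fun f f = 0 -> f = 0.
Proof.
move=> f0; apply/val_inj/funext => x; change (f x = 0).
have := sqr_le_dot f x; rewrite f0 => h; apply/eqP; rewrite -sqrf_eq0.
by rewrite eq_le sqr_ge0 andbT -(ler_pM2r (theta_gt0 x)) mul0r.
Qed.

Definition l2dot : inner_product l2 :=
  InnerProduct dot_funC dot_funDl dot_funZl dot_fun_ge0 dot_fun_eq0.

Lemma l2dotE f g : l2dot f g = isum (fun x => f x * g x * theta x).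
Proof. by []. Qed.

Lemma l2norm_nrm f : l2norm theta f = nrm l2dot f.
Proof. by rewrite /nrm l2dotE -/(dot_fun f f) dot_fun_sqr. Qed.

Lemma pointwise_le_nrm f x : `|f x| <= nrm l2dot f / Num.sqrt (theta x).
Proof.
have t0 : 0 < Num.sqrt (theta x) by rewrite sqrtr_gt0.
rewrite ler_pdivlMr// -ler_sqr ?nnegrE ?nrm_ge0 ?mulr_ge0 ?sqrtr_ge0//.
rewrite exprMn real_normK ?num_real// sqr_sqrtr ?(ltW (theta_gt0 x))// nrm_sqr.
exact: sqr_le_dot.
Qed.

(** Norm convergence controls values at each vertex, which gives a pointwise limit [f]. On a finite
    set the sum of |u i - u j|^2 is at most e^2; letting [j] tend to infinity and then exhausting
    [G] bounds u i - f. *)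
Lemma l2_complete : complete_ip l2dot.
Proof.
move=> u cu.
have pc x : exists l : R, u^~ x @ \oo --> l.
  apply: real_cauchy => e e0.
  have t0 : 0 < Num.sqrt (theta x) by rewrite sqrtr_gt0.
  have [n hn] := cu _ (mulr_gt0 e0 t0).
  exists n => i j ni nj; apply: le_trans (pointwise_le_nrm (u i - u j) x) _.
  by rewrite ler_pdivrMr//; exact: hn.
have [f hf] := choice pc.
have key e : 0 < e -> exists n, forall i, (n <= i)%N ->
    nnsummable (fun x => (u i x - f x) ^+ 2 * theta x) /\
    nnsum (fun x => (u i x - f x) ^+ 2 * theta x) <= e ^+ 2.
  move=> e0; have [n hn] := cu _ e0; exists n => i ni.
  apply: nnsummable_le => [x|A]; first by rewrite mulr_ge0 ?sqr_ge0// ltW.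
  have lim : (fun j : nat => \sum_(x <- A) (u i x - u j x) ^+ 2 * theta x) @ \oo -->
      \sum_(x <- A) (u i x - f x) ^+ 2 * theta x.
    apply: cvg_big => [|x _]; first exact: add_continuous.
    apply: cvgMl; rewrite expr2.
    under eq_fun do rewrite expr2.
    by apply: cvgM; apply: cvgB; [exact: cvg_cst|exact: hf|exact: cvg_cst|exact: hf].
  rewrite -(cvg_lim _ lim)//; apply: limr_le.
    by apply/cvg_ex; exists (\sum_(x <- A) (u i x - f x) ^+ 2 * theta x).
  exists n => // j /= nj.
  have : nrm l2dot (u i - u j) ^+ 2 <= e ^+ 2.
    by rewrite ler_sqr ?nnegrE ?nrm_ge0 ?(ltW e0)//; exact: hn.
  rewrite nrm_sqr; apply: le_trans.
  rewrite l2dotE -/(dot_fun _ _) dot_fun_sqr.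
  by apply: (@nnsum_ge R G (fun x => (u i - u j) x ^+ 2 * theta x)); apply/L2P/l2_L2.
have fL2 : L2 theta f.
  have [n /(_ n (leqnn n))[s _]] := key 1 ltr01.
  have -> : f = (u n : G -> R) + (-1) *: ((u n : G -> R) - f).
    by apply/funext => x; rewrite scaleN1r opprB addrC subrK.
  by apply: L2D; [exact: l2_L2|apply: L2Z; apply/L2P].
exists (mkl2 fL2) => e e0; have [n hn] := key e e0; exists n => i /hn[_ h].
rewrite -ler_sqr ?nnegrE ?nrm_ge0 ?(ltW e0)// nrm_sqr l2dotE -/(dot_fun _ _).
by rewrite dot_fun_sqr.
Qed.

Lemma nrm_cvg_pointwise (u : nat -> l2) f x :
  nrm_cvg l2dot u f -> u^~ x @ \oo --> f x.
Proof.
move=> h; apply/cvgrPdist_le => e e0.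
have t0 : 0 < Num.sqrt (theta x) by rewrite sqrtr_gt0.
have [n hn] := h _ (mulr_gt0 e0 t0); exists n => // i /= ni.
rewrite distrC; apply: le_trans (pointwise_le_nrm (u i - f) x) _.
by rewrite ler_pdivrMr//; exact: hn.
Qed.

End L2Space.

(** * The maximum principle *)

Section GraphOperator.
Variables (R : realType) (G : countType).
Variables (E : rel G) (pi : G -> G -> R) (theta : G -> R).
Hypothesis graphE : is_graph E.
Hypothesis weight_pi : is_edge_weight E pi.
Hypothesis theta_gt0 : forall x, 0 < theta x.
Implicit Types (f g k : G -> R) (x y z : G) (A B : {fset G}).

Local Notation negl := (neg_laplacian E pi theta).

Definition nbf x : {fset G} := fset_set (nbrs E x).

Lemma in_nbf x y : (y \in nbf x) = E x y.
Proof.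
rewrite /nbf in_fset_set; last exact: edge_locally_finite.
by apply/idP/idP; rewrite inE.
Qed.

Lemma weight_eq0 x y : ~~ E x y -> pi x y = 0.
Proof.
move=> nE; apply/eqP; rewrite eq_le (weight_ge0 weight_pi) andbT leNgt.
by apply/negP => /(weight_gt0 weight_pi); exact/negP.
Qed.

Lemma neglE f x : theta x * negl f x = \sum_(y <- nbf x) pi x y * (f x - f y).
Proof.
rewrite /neg_laplacian /laplacian fsbig_finite; last exact: edge_locally_finite.
rewrite mulrN mulrA divff ?gt_eqF// mul1r -sumrN; apply: eq_bigr => y _.
by ring.
Qed.

Lemma negl_lin c f g x : negl (c *: f + g) x = c * negl f x + negl g x.
Proof.
apply: (mulfI (lt0r_neq0 (theta_gt0 x))).
rewrite mulrDr mulrCA !neglE mulr_sumr -big_split; apply: eq_bigr => y _ /=.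
have e z : (c *: f + g) z = c * f z + g z by [].
by rewrite !e; ring.
Qed.

(** Since [pi] vanishes off the edges, neighbour sums can be taken over any common finite set that
    misses no nonzero term. *)
Lemma sum_nbf (w : G -> R) x B :
  (forall y, y \in nbf x -> y \notin B -> w y = 0) ->
  \sum_(y <- nbf x) pi x y * w y = \sum_(y <- B) pi x y * w y.
Proof.
move=> h; rewrite (big_fset_incl _ (fsubsetUl (nbf x) B)) => [|y _]; last first.
  by rewrite in_nbf => /weight_eq0 ->; rewrite mul0r.
rewrite [RHS](big_fset_incl _ (fsubsetUr (nbf x) B))// => y + yB.
by rewrite in_fsetU (negPf yB) orbF => /h -> //; rewrite mulr0.
Qed.

Lemma sum_symmetrize f g B :
  \sum_(x <- B) \sum_(y <- B) pi x y * (f x * (g x - g y)) =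
  2^-1 * \sum_(x <- B) \sum_(y <- B) pi x y * ((f x - f y) * (g x - g y)).
Proof.
set S := LHS; have S2 : S = \sum_(x <- B) \sum_(y <- B) pi x y * (f y * (g y - g x)).
  rewrite /S exchange_big /=; apply: eq_bigr => x _; apply: eq_bigr => y _.
  by rewrite (weight_sym weight_pi).
have -> : S = 2^-1 * (S + S) by field.
congr (_ * _); rewrite {2}S2 /S -big_split; apply: eq_bigr => x _ /=.
by rewrite -big_split; apply: eq_bigr => y _ /=; ring.
Qed.

Definition nbhd A : {fset G} := (A `|` \bigcup_(x <- A) nbf x)%fset.

Lemma nbhd_sub A x : x \in A -> x \in nbhd A.
Proof. by move=> xA; rewrite in_fsetU xA. Qed.

Lemma nbhd_nbf A x y : x \in A -> E x y -> y \in nbhd A.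
Proof.
move=> xA xy; rewrite in_fsetU; apply/orP; right.
by apply/bigfcupP; exists x; rewrite ?xA ?in_nbf.
Qed.

Lemma negl_supp A k x : (forall x, x \notin A -> k x = 0) ->
  x \notin nbhd A -> negl k x = 0.
Proof.
move=> kA xB; apply: (mulfI (lt0r_neq0 (theta_gt0 x))).
rewrite neglE mulr0 big_seq big1// => y; rewrite in_nbf => xy.
rewrite (kA x) ?(kA y) ?subrr ?mulr0//.
  by apply: contra xB => /nbhd_nbf; apply; rewrite (edge_sym graphE).
by apply: contra xB; exact: nbhd_sub.
Qed.

(** Green's formula on the finite set [nbhd A]. An edge leaving this set has both ends outside [A],
    where [k] vanishes, so no boundary term appears. *)
Lemma green_l A f k : (forall x, x \notin A -> k x = 0) ->
  \sum_(x <- nbhd A) f x * negl k x * theta x = 2^-1 *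
   \sum_(x <- nbhd A) \sum_(y <- nbhd A) pi x y * ((f x - f y) * (k x - k y)).
Proof.
move=> kA; rewrite -sum_symmetrize; apply: eq_big_seq => x xB.
rewrite -mulrA [negl k x * _]mulrC neglE (sum_nbf (B := nbhd A)).
  by rewrite mulr_sumr; apply: eq_bigr => y _; ring.
move=> y; rewrite in_nbf => xy yB; rewrite (kA x) ?(kA y) ?subrr//.
  by apply: contra yB; exact: nbhd_sub.
by apply: contra yB => /nbhd_nbf; exact.
Qed.

(** Now the operator falls on the arbitrary [f]: vertices outside [A] are killed by the factor
    [k x], and those in [A] have all their neighbours in [nbhd A]. *)
Lemma green_r A f k : (forall x, x \notin A -> k x = 0) ->
  \sum_(x <- nbhd A) negl f x * k x * theta x = 2^-1 *
   \sum_(x <- nbhd A) \sum_(y <- nbhd A) pi x y * ((f x - f y) * (k x - k y)).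
Proof.
move=> kA.
have -> : \sum_(x <- nbhd A) \sum_(y <- nbhd A) pi x y * ((f x - f y) * (k x - k y))
  = \sum_(x <- nbhd A) \sum_(y <- nbhd A) pi x y * ((k x - k y) * (f x - f y)).
  by apply: eq_bigr => x _; apply: eq_bigr => y _; rewrite (mulrC (f x - f y)).
rewrite -sum_symmetrize; apply: eq_big_seq => x xB.
have [xA|/kA ->] := boolP (x \in A); last first.
  by rewrite mulr0 mul0r big1// => y _; rewrite mul0r mulr0.
rewrite mulrAC [negl f x * _]mulrC neglE (sum_nbf (B := nbhd A)).
  by rewrite mulr_suml; apply: eq_bigr => y _; ring.
by move=> y; rewrite in_nbf => xy; rewrite (nbhd_nbf xA xy).
Qed.

(** The connected component of [x] in [B]. The path lists the vertices after [x], so [B x] is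
    assumed separately wherever it matters. *)
Definition reach (B : set G) x y :=
  exists s, [/\ path E x s, last x s = y & [set` s] `<=` B].

Lemma reach_trans (B : set G) x y z : reach B x y -> reach B y z -> reach B x z.
Proof.
move=> [s [ps ls sB]] [t [pt lt tB]]; exists (s ++ t); split.
- by rewrite cat_path ps ls.
- by rewrite last_cat ls.
- by move=> v /=; rewrite mem_cat => /orP[/sB|/tB].
Qed.

Lemma reach_edge (B : set G) x y : E x y -> B y -> reach B x y.
Proof.
move=> xy By; exists [:: y]; split=> //=; first by rewrite xy.
by move=> v /=; rewrite inE => /eqP ->.
Qed.

Lemma reach_sym (B : set G) x y : B x -> reach B x y -> reach B y x.
Proof.
move=> Bx [s [+ + +]]; elim: s x Bx => [|v s IH] x Bx /=.
  by move=> _ <- _; exists [::].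
move=> /andP[xv ps] ls sB.
have Bv : B v by apply: sB; rewrite /= inE eqxx.
apply: (@reach_trans _ _ v).
  by apply: IH => // w /= ws; apply: sB; rewrite /= inE ws orbT.
by apply: reach_edge => //; rewrite (edge_sym graphE).
Qed.

Lemma reach_path (B : set G) x s v : path E x s -> [set` s] `<=` B -> v \in s ->
  reach B x v.
Proof.
elim: s x => [//|w s IH] x /= /andP[xw ps] sB.
have Bw : B w by apply: sB; rewrite /= inE eqxx.
have xw' : reach B x w by exact: reach_edge.
rewrite inE => /orP[/eqP -> //|vs].
apply: reach_trans xw' _; apply: IH => // u /= us.
by apply: sB; rewrite /= inE us orbT.
Qed.

Lemma reach_connected (B : set G) x : B x -> graph_connected E (reach B x).
Proof.
move=> Bx y z xy xz.
have [s [ps ls sB]] := reach_trans (reach_sym Bx xy) xz.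
exists s; split=> // v /= vs.
by apply: reach_trans xy _; exact: reach_path vs.
Qed.

Lemma reach_sub (B : set G) x y : B x -> reach B x y -> B y.
Proof.
move=> Bx [s [_ <- sB]]; have := mem_last x s; rewrite inE => /orP[/eqP -> //|].
exact: sB.
Qed.

Hypothesis theta_infinite : forall U : set G,
  infinite_set U -> graph_connected E U -> mass theta U = +oo%E.

(** A component is connected and its mass is at most that of [B]; were it infinite, its mass would
    be infinite. *)
Lemma reach_finite (B : set G) x : (mass theta B < +oo)%E -> B x ->
  finite_set (reach B x).
Proof.
move=> mB Bx; apply: contrapT => inf.
have := theta_infinite inf (reach_connected Bx).
apply/eqP; rewrite lt_eqF//; apply: le_lt_trans mB.
apply: ge_ereal_sup => _ [X [finX XU] <-]; apply: ereal_sup_ubound.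
by exists X => //; split=> // y /XU; exact: reach_sub.
Qed.

(** Chebyshev's inequality. *)
Lemma mass_level (f : G -> R) (e : R) : L2 theta f -> 0 < e ->
  (mass theta [set x | (e <= f x)%R] < +oo)%E.
Proof.
move=> /(L2P theta_gt0) fs e0.
have e2 : 0 < e ^+ 2 by rewrite exprn_gt0.
apply: (@le_lt_trans _ _
  ((e ^+ 2)^-1 * nnsum (fun x => f x ^+ 2 * theta x))%:E); last exact: ltry.
apply: esum_le_bound => A hA.
rewrite ler_pdivlMl//; apply: le_trans (nnsum_ge A fs).
rewrite mulr_sumr [leLHS]big_seq [leRHS]big_seq; apply: ler_sum => x /hA /= ex.
by rewrite ler_pM2r// ler_sqr ?nnegrE ?(ltW e0)// (le_trans (ltW e0) ex).
Qed.

Lemma seq_max (s : seq G) f x : x \in s ->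
  exists2 z, z \in s & forall y, y \in s -> f y <= f z.
Proof.
elim: s x => [//|v s IH] x _; case: s IH => [_|w s IH].
  by exists v; rewrite ?inE// => y; rewrite inE => /eqP ->.
have [z zs zmax] := IH w (mem_head _ _).
have [vz|zv] := leP (f v) (f z).
  by exists z; rewrite 1?inE ?zs ?orbT// => y; rewrite inE => /orP[/eqP ->|/zmax].
exists v; rewrite 1?inE ?eqxx// => y; rewrite inE => /orP[/eqP ->//|/zmax yz].
exact: le_trans yz (ltW zv).
Qed.

(* At a maximum z of f on the finite component of {f >= f x} containing x, the
   equation forces a neighbour with a larger value. *)
Lemma subsolution_le0 f : L2 theta f -> (forall x, negl f x = - f x) ->
  forall x, f x <= 0.
Proof.
move=> fL2 eqf x; rewrite leNgt; apply/negP => fx0.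
pose B := [set y | (f x <= f y)%R].
have Bx : B x by rewrite /B /=.
have fin := reach_finite (mass_level fL2 fx0) Bx.
have mem y : (y \in fset_set (reach B x)) <-> reach B x y.
  by rewrite in_fset_set// inE.
have xr : x \in fset_set (reach B x) by apply/mem; exists [::].
have [z /mem xz zmax] := seq_max f xr.
have fz : f x <= f z by exact: (reach_sub Bx xz).
have : theta z * negl f z < 0.
  rewrite eqf; have := mulr_gt0 (theta_gt0 z) (lt_le_trans fx0 fz).
  by rewrite mulrN oppr_lt0.
rewrite neglE ltNge => /negP; apply; rewrite big_seq; apply: sumr_ge0 => y.
rewrite in_nbf => zy; rewrite mulr_ge0 ?(weight_ge0 weight_pi)// subr_ge0.
rewrite leNgt; apply/negP => zfy.
suff : f y <= f z by rewrite leNgt zfy.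
apply: zmax; apply/mem; apply: reach_trans xz _.
by apply: reach_edge => //; rewrite /B /=; exact: le_trans fz (ltW zfy).
Qed.

End GraphOperator.

(** * The Laplacian as a symmetric operator *)

Section L2Operator.
Variables (R : realType) (G : countType).
Variables (E : rel G) (pi : G -> G -> R) (theta : G -> R).
Hypothesis graphE : is_graph E.
Hypothesis weight_pi : is_edge_weight E pi.
Hypothesis theta_gt0 : forall x, 0 < theta x.

Local Notation negl := (neg_laplacian E pi theta).
Local Notation l2 := (l2 theta_gt0).
Local Notation dot := (l2dot theta_gt0).

Definition dom : set l2 := [set f | L2 theta (negl f)].

Definition lap_op (f : l2) : l2 :=
  if pselect (L2 theta (negl f)) is left h then mkl2 theta_gt0 h else 0.

Lemma lap_opE f x : dom f -> lap_op f x = negl f x.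
Proof. by rewrite /lap_op; case: pselect. Qed.

Lemma l2_eqP (f g : l2) : (forall x, f x = g x) -> f = g.
Proof. by move=> h; apply/val_inj/funext. Qed.

Lemma lap_op_linear : linear_on dom lap_op.
Proof.
have e c (f g : l2) : negl (c *: f + g) = c *: negl f + negl g.
  by apply/funext => x; rewrite [LHS](negl_lin pi graphE theta_gt0).
have dl c f g : dom f -> dom g -> dom (c *: f + g).
  move=> Df Dg; rewrite /dom /= e.
  by apply: (L2D theta_gt0) => //; exact: (L2Z theta_gt0).
split=> // [|c f g Df Dg].
  rewrite /dom /=; suff -> : negl (0 : l2) = 0 by exact: l2_L2 (0 : l2).
  apply/funext => x; apply: (mulfI (lt0r_neq0 (theta_gt0 x))).
  rewrite (neglE pi graphE theta_gt0) mulr0 big1// => y _.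
  by rewrite !l20E subrr mulr0.
apply: l2_eqP => x; rewrite lap_opE; last exact: dl.
by rewrite e l2DE l2ZE !lap_opE.
Qed.

Definition Cc : set l2 :=
  [set k | exists A : {fset G}, forall x, x \notin A -> k x = 0].

Lemma Cc_dom : Cc `<=` dom.
Proof.
move=> k [A kA]; apply: (L2_finite theta_gt0 (A := nbhd E A)) => x.
exact: (negl_supp pi graphE theta_gt0 kA).
Qed.

Lemma Cc0 : Cc 0.
Proof. by exists fset0. Qed.

Lemma Cc_lin c f g : Cc f -> Cc g -> Cc (c *: f + g).
Proof.
move=> [A fA] [B gB]; exists (A `|` B)%fset => x.
rewrite in_fsetU negb_or => /andP[xA xB].
by rewrite l2DE l2ZE fA// gB// mulr0 addr0.
Qed.

Lemma dot_Cc_r (f k : l2) A : (forall x, x \notin A -> k x = 0) ->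
  dot f (lap_op k) = 2^-1 * \sum_(x <- nbhd E A) \sum_(y <- nbhd E A)
    pi x y * ((f x - f y) * (k x - k y)).
Proof.
move=> kA; rewrite -(green_l graphE weight_pi theta_gt0 f kA) l2dotE.
have Dk : dom k by apply: Cc_dom; exists A.
rewrite (isum_fset (A := nbhd E A)) => [|x xA].
  by apply: eq_bigr => x _; rewrite lap_opE.
by rewrite lap_opE// (negl_supp pi graphE theta_gt0 kA)// mulr0 mul0r.
Qed.

Lemma Cc_sym f g : Cc f -> Cc g -> dot (lap_op f) g = dot f (lap_op g).
Proof.
move=> [A fA] [B gB].
have fAB x : x \notin (A `|` B)%fset -> f x = 0.
  by rewrite in_fsetU negb_or => /andP[/fA].
have gAB x : x \notin (A `|` B)%fset -> g x = 0.
  by rewrite in_fsetU negb_or => /andP[_ /gB].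
rewrite ipC (dot_Cc_r g fAB) (dot_Cc_r f gAB); congr (_ * _).
by apply: eq_bigr => x _; apply: eq_bigr => y _; rewrite (mulrC (g x - g y)).
Qed.

Lemma Cc_ge0 f : Cc f -> 0 <= dot (lap_op f) f.
Proof.
move=> [A fA]; rewrite ipC (dot_Cc_r f fA) mulr_ge0//.
apply: sumr_ge0 => x _; apply: sumr_ge0 => y _.
by rewrite mulr_ge0 ?(weight_ge0 weight_pi)// -expr2 sqr_ge0.
Qed.

(** Norm convergence implies pointwise convergence, and the operator at a vertex is a finite sum, so
    both limits can be compared vertex by vertex. *)
Lemma lap_op_closed (u : nat -> l2) l w : (forall i, dom (u i)) ->
  nrm_cvg dot u l -> nrm_cvg dot (lap_op \o u) w -> dom l /\ lap_op l = w.
Proof.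
move=> Du ul uw.
have e : negl l = w.
  apply/funext => x; apply: (mulfI (lt0r_neq0 (theta_gt0 x))).
  have c1 : (fun i => theta x * negl (u i) x) @ \oo --> theta x * w x.
    have -> : (fun i => theta x * negl (u i) x) =
        (fun i => theta x * (lap_op \o u) i x).
      by apply/funext => i /=; rewrite lap_opE.
    by apply: cvgMr; exact: (nrm_cvg_pointwise (x := x) uw).
  have c2 : (fun i => theta x * negl (u i) x) @ \oo --> theta x * negl l x.
    rewrite (neglE pi graphE theta_gt0).
    under eq_fun do rewrite (neglE pi graphE theta_gt0).
    apply: cvg_big => [|y _]; first exact: add_continuous.
    by apply: cvgMr; apply: cvgB; exact: nrm_cvg_pointwise.
  by rewrite -(cvg_lim _ c1)// -(cvg_lim _ c2).
have Dl : dom l by rewrite /dom /= e; exact: l2_L2.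
by split=> //; apply: l2_eqP => x; rewrite lap_opE// e.
Qed.

Lemma delta_L2 x : L2 theta (fun y => (y == x)%:R).
Proof.
apply: (L2_finite theta_gt0 (A := [fset x]%fset)) => y.
by rewrite in_fset1 => /negPf ->.
Qed.

(** Testing against the indicator of [x] and moving the operator onto [g] by Green's formula leaves
    the equation at [x] times [theta x]. *)
Lemma lap_op_adjoint g : (forall k, Cc k -> dot g (lap_op k + k) = 0) ->
  dom g /\ lap_op g = - g.
Proof.
move=> h.
have e x : negl g x = - g x.
  pose k : l2 := mkl2 theta_gt0 (delta_L2 x).
  pose A := [fset x]%fset.
  have kA y : y \notin A -> k y = 0 by rewrite in_fset1 => /negPf /= ->.
  have Ck : Cc k by exists A.
  have := h k Ck; rewrite ipDr (dot_Cc_r g kA).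
  rewrite -(green_r graphE weight_pi theta_gt0 g kA) l2dotE.
  rewrite (isum_fset (A := nbhd E A)) => [|y yA]; last first.
    by rewrite kA ?mulr0 ?mul0r//; apply: contra yA; exact: nbhd_sub.
  rewrite -big_split /=.
  have sub : (A `<=` nbhd E A)%fset by apply/fsubsetP => y; exact: nbhd_sub.
  rewrite -(big_fset_incl _ sub) => [|y _ /kA /= ->]; last first.
    by rewrite !mulr0 !mul0r addr0.
  rewrite big_seq_fset1 /= eqxx !mulr1 -mulrDl => /eqP.
  by rewrite mulf_eq0 (gt_eqF (theta_gt0 x)) orbF addr_eq0 => /eqP.
have Dg : dom g.
  rewrite /dom /=; have -> : negl g = (- g : l2) by apply/funext => x; rewrite e.
  exact: l2_L2.
by split=> //; apply: l2_eqP => x; rewrite lap_opE// e.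
Qed.

Hypothesis theta_infinite : forall U : set G,
  infinite_set U -> graph_connected E U -> mass theta U = +oo%E.

(** The maximum principle applies to both [f] and [- f]. *)
Lemma lap_op_inj f : dom f -> lap_op f = - f -> f = 0.
Proof.
move=> Df fe; have e x : negl f x = - f x by rewrite -lap_opE// fe.
have le0 := subsolution_le0 graphE weight_pi theta_gt0 theta_infinite.
apply: l2_eqP => x; apply/eqP; rewrite eq_le le0//; last exact: l2_L2.
rewrite /= -oppr_le0 -l2NE; apply: le0; first exact: l2_L2.
move=> y; have DN : dom (- f) by exact: (domN lap_op_linear).
by rewrite -lap_opE// (opN lap_op_linear Df) fe.
Qed.

Lemma lap_op_sym f g : dom f -> dom g -> dot (lap_op f) g = dot f (lap_op g).
Proof.
exact: (core_sym (@l2_complete _ _ _ theta_gt0) lap_op_linear Cc_dom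
  Cc0 Cc_lin Cc_sym Cc_ge0 lap_op_closed lap_op_adjoint lap_op_inj).
Qed.

Lemma lap_op_ge0 f : dom f -> 0 <= dot (lap_op f) f.
Proof.
exact: (core_ge0 (@l2_complete _ _ _ theta_gt0) lap_op_linear Cc_dom
  Cc0 Cc_lin Cc_ge0 lap_op_closed lap_op_adjoint lap_op_inj).
Qed.

(** * From the resolvent set and eigenspaces of functions to those of [lap_op] *)

Local Notation resolvent := (resolvent_set theta (laplacian_dom E pi theta) negl).

Lemma laplacian_domP (f : l2) : laplacian_dom E pi theta f <-> dom f.
Proof.
have e : L2 theta (negl f) <-> L2 theta (laplacian E pi theta f).
  rewrite /L2 /l2normsq /=; under eq_esum do rewrite sqrrN.
  by [].
by split=> [[_ /e]|/e h] //; split=> //; exact: l2_L2.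
Qed.

Lemma resolvent_regular l : resolvent l -> regular dot dom lap_op l.
Proof.
move=> [surj [C hC]]; split=> [g|].
  have [f [[[fL2 Lf] fg] _]] := surj g (l2_L2 g).
  have Df : dom (mkl2 theta_gt0 fL2) by apply/laplacian_domP.
  exists (mkl2 theta_gt0 fL2) => //; apply: l2_eqP => x.
  by rewrite l2DE l2NE l2ZE lap_opE// -fg.
exists (`|C| + 1) => [|f Df]; first by rewrite ltr_wpDl.
have /hC : laplacian_dom E pi theta f by exact/laplacian_domP.
have -> : (fun x => negl f x - l * f x) = (lap_op f - l *: f : l2).
  by apply/funext => x; rewrite l2DE l2NE l2ZE lap_opE.
rewrite !l2norm_nrm => /le_trans; apply; apply: ler_wpM2r; first exact: nrm_ge0.
by have := ler_norm C; lra.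
Qed.

(** Take the largest [n] admitting [n] independent eigenfunctions. A nonzero eigenfunction [h]
    orthogonal to all of them would extend the family: pairing a relation with [h] kills the
    coefficient of [h], and independence the others. *)
Lemma eigenspace_seq l :
  ~ infinite_dimensional (Defs.eigenspace (laplacian_dom E pi theta) negl l) ->
  exists2 s : seq l2, (forall e, e \in s -> dom e /\ lap_op e = l *: e) &
    forall h, dom h -> lap_op h = l *: h -> perp dot s h -> h = 0.
Proof.
move=> ninf.
pose P n := exists e : 'I_n -> l2, (forall i, dom (e i) /\ lap_op (e i) = l *: e i) /\
   forall c : 'I_n -> R, \sum_(i < n) c i *: e i = 0 -> forall i, c i = 0.
have sumE n (c : 'I_n -> R) (e : 'I_n -> l2) x :
    (\sum_(i < n) c i *: e i) x = \sum_(i < n) c i * e i x.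
  by elim/big_ind2 : _ => // u a v b <- <-.
have eigP (f : l2) : (dom f /\ lap_op f = l *: f) ->
    Defs.eigenspace (laplacian_dom E pi theta) negl l f.
  move=> [Df fe]; split; first exact/laplacian_domP.
  by move=> x; rewrite -lap_opE// fe.
have [n nP] : exists n, ~ P n.
  apply: contrapT => all; apply: ninf => n.
  have [e [eig ind]] : P n by apply: contrapT => nP; apply: all; exists n.
  exists (fun i => e i : G -> R); split=> [i|c ce]; first exact/eigP/eig.
  by apply: ind; apply: l2_eqP => x; rewrite sumE ce.
elim: n nP => [|n IH] nP.
  exfalso; apply: nP; exists (fun i => 0); split; first by case.
  by move=> c _; case.
have [Pn|/IH//] := pselect (P n).
have [e [eig ind]] := Pn.
exists [seq e i | i <- enum 'I_n]; first by move=> _ /mapP[i _ ->]; exact: eig.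
move=> h Dh he ph; apply: contrapT => hn0; apply: nP.
have pe i : dot (e i) h = 0.
  by apply: ph; apply/mapP; exists i; rewrite ?mem_enum.
exists (fun i => if unlift ord_max i is Some j then e j else h); split.
  by move=> i; case: unlift => [j|]; [exact: eig | split].
move=> c; rewrite big_ord_recr /= unlift_none.
under eq_bigr => i _.
  have -> : widen_ord (leqnSn n) i = lift ord_max i.
    by apply/val_inj; rewrite /= /bump leqNgt ltn_ord.
  rewrite liftK; over.
move=> ce.
have cm : c ord_max = 0.
  have : dot (\sum_(i < n) c (lift ord_max i) *: e i + c ord_max *: h) h = 0.
    by rewrite ce ip0l.
  rewrite ipDl ipZl.
  have -> : dot (\sum_(i < n) c (lift ord_max i) *: e i) h = 0.
    elim/big_ind : _ => [|u v u0 v0|i _]; rewrite ?ip0l//.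
      by rewrite ipDl u0 v0 addr0.
    by rewrite ipZl pe mulr0.
  rewrite add0r => /eqP; rewrite mulf_eq0 => /orP[/eqP //|/eqP /ip_eq0 h0].
  by exfalso; exact: hn0.
move: ce; rewrite cm scale0r addr0 => /ind c0 i.
by case: (unliftP ord_max i) => [j ->|->].
Qed.

End L2Operator.

(** * Volume growth and test functions *)

Section VolumeGrowth.
Variables (R : realType) (G : countType) (theta : G -> R) (rho : G -> G -> R).
Variable x0 : G.
Hypothesis theta_gt0 : forall x, 0 < theta x.
Hypothesis rho_ge0 : forall x, 0 <= rho x0 x.

Lemma volume_growth_exp : (volume_growth theta rho x0 < +oo)%E ->
  exists K M, [/\ 0 <= K, 0 <= M & forall r (A : {fset G}), M < r ->
     (forall x, x \in A -> rho x0 x <= r) -> \sum_(x <- A) theta x <= expR (K * r)].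
Proof.
move=> /ereal_inf_lt[_ [V [M [Mreal hV]] <-] supV].
have [K K0 hK] : exists2 K : R, 0 <= K & (ereal_sup [set ((r^-1)%:E *
     lne (mass theta (closed_rho_ball rho x0 r)))%E | r in V] <= K%:E)%E.
  move: supV; case: (ereal_sup _) => [k| |] //= _; last by exists 0; rewrite ?leNye.
  by exists `|k| => //; rewrite lee_fin ler_norm.
(* The maximum with 0 makes [r] positive, so that the factor [r^-1] can be cleared. *)
exists K, (Num.max M 0); split=> //; first by rewrite le_max lexx orbT.
move=> r A; rewrite gt_max => /andP[Mr r0] hA.
have := le_trans (ereal_sup_ubound (imageP _ (hV _ Mr))) hK.
have := fsum_le_esum theta (U := closed_rho_ball rho x0 r) hA.
(* A nonpositive mass is below any exponential, a positive real one is bounded through its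
   logarithm, and an infinite one contradicts the bound by [K]. *)
rewrite -/(mass _ _); case: (mass _ _) => [v| |] //=.
  rewrite lee_fin => Av; case: ifPn => [v0 _|].
    by apply: le_trans Av (le_trans v0 _); exact: expR_ge0.
  rewrite -ltNge => v0; rewrite -EFinM lee_fin ler_pdivrMl// mulrC => h.
  by apply: le_trans Av _; rewrite -(lnK v0) ler_expR.
by move=> _; rewrite gt0_muley// lte_fin invr_gt0.
Qed.

Lemma geometric_half_sum N : \sum_(n < N) expR (- (n%:R : R)) <= 2.
Proof.
suff : \sum_(n < N) expR (- (n%:R : R)) <= 2 - 2 * 2^-1 ^+ N.
  by move=> /le_trans; apply; rewrite gerBl mulr_ge0// exprn_ge0.
elim: N => [|N IH]; first by rewrite big_ord0 expr0; lra.
rewrite big_ord_recr /= exprS.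
have : expR (- (N%:R : R)) <= 2^-1 ^+ N.
  rewrite exprVn expRN lef_pV2 ?posrE ?expR_gt0 ?exprn_gt0//.
  rewrite -[N%:R]mulr1 expRM_natl.
  by rewrite lerXn2r ?nnegrE ?expR_ge0//; have := @expR_ge1Dx R 1; lra.
lra.
Qed.

(** Split [G] into shells n <= rho x0 x < n + 1. The weight is at most exp (- (K + 1) n) on a shell
    whose mass is at most a constant times exp (K n), leaving a geometric series. *)
Lemma exp_weight_summable (K M : R) : 0 <= K -> 0 <= M ->
  (forall r (A : {fset G}), M < r ->
     (forall x, x \in A -> rho x0 x <= r) -> \sum_(x <- A) theta x <= expR (K * r)) ->
  nnsummable (fun x => expR (- (K + 1) * rho x0 x) * theta x).
Proof.
move=> K0 M0 vol.
apply: (nnsummable_le (c := 2 * expR (K * (M + 2))) _ _).1 => [x|A].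
  by rewrite mulr_ge0 ?expR_ge0// ltW.
have [N hN] : exists N, forall x, x \in A -> (Num.truncn (rho x0 x) < N)%N.
  exists (\max_(x <- A) (Num.truncn (rho x0 x))).+1 => x xA.
  by rewrite ltnS; apply: (leq_bigmax_seq x).
pose t (n : nat) x := if rho x0 x <= n%:R + 1 then theta x else 0.
have t0 n x : 0 <= t n x by rewrite /t; case: ifP => // _; exact: ltW.
have h1 x : x \in A -> expR (- (K + 1) * rho x0 x) * theta x <=
    \sum_(n < N) expR (- (K + 1) * n%:R) * t n x.
  move=> xA; have /andP[n1 n2] := truncn_itv (rho_ge0 x).
  rewrite (bigD1 (Ordinal (hN x xA))) //= ler_wpDr//.
    by apply: sumr_ge0 => i _; rewrite mulr_ge0 ?expR_ge0.
  rewrite /t natr1 (ltW n2) ler_wpM2r ?(ltW (theta_gt0 x))//.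
  by rewrite ler_expR !mulNr lerN2 ler_wpM2l//; lra.
apply: (@le_trans _ _ (\sum_(x <- A) \sum_(n < N) expR (- (K + 1) * n%:R) * t n x)).
  by rewrite [leLHS]big_seq [leRHS]big_seq; apply: ler_sum => x /h1.
rewrite exchange_big /=.
(* The volume bound holds for radii above [M] only, so the radius [n + 1] is enlarged to
   [M + n + 2]. *)
have h2 n : \sum_(x <- A) t n x <= expR (K * (M + n%:R + 2)).
  rewrite /t -big_mkcond /= big_fset_condE /=.
  apply: vol; first by have : 0 <= (n%:R : R) by []; lra.
  by move=> x; rewrite !inE /= => /andP[_]; have : 0 <= (n%:R : R) by []; lra.
apply: (@le_trans _ _ (\sum_(n < N) expR (- n%:R) * expR (K * (M + 2)))).
  apply: ler_sum => n _; rewrite -mulr_sumr.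
  apply: le_trans (ler_wpM2l (expR_ge0 _) (h2 n)) _.
  by rewrite -!expRD ler_expR; lra.
by rewrite -mulr_suml ler_wpM2r ?expR_ge0// geometric_half_sum.
Qed.

End VolumeGrowth.

Lemma expR_sub1_le (R : realType) (s : R) : `|1 - expR s| <= `|s| * expR `|s|.
Proof.
have h1 := expR_ge1Dx s; have h2 := expR_ge1Dx (- s).
have [s0|s0] := leP 0 s.
  rewrite (ger0_norm s0) ler0_norm; last by lra.
  have : expR s * expR (- s) = 1 by rewrite -expRD subrr expR0.
  have := ler_wpM2l (expR_ge0 s) h2; lra.
rewrite (ltr0_norm s0) ger0_norm; last by rewrite subr_ge0 expR_le1 ltW.
have : 1 <= expR (- s) by rewrite -expR0 ler_expR; lra.
move=> h3; have : - s * 1 <= - s * expR (- s) by apply: ler_wpM2l => //; lra.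
lra.
Qed.

(** * Finitely supported truncations and weak smallness *)

Section Truncation.
Variables (R : realType) (G : countType).
Variables (E : rel G) (pi : G -> G -> R) (theta : G -> R) (rho : G -> G -> R).
Hypothesis graphE : is_graph E.
Hypothesis weight_pi : is_edge_weight E pi.
Hypothesis theta_gt0 : forall x, 0 < theta x.
Hypothesis theta_infinite : forall U : set G,
  infinite_set U -> graph_connected E U -> mass theta U = +oo%E.
Hypothesis adapted_rho : adapted E pi theta rho.

Local Notation l2 := (l2 theta_gt0).
Local Notation dot := (l2dot theta_gt0).
Local Notation lap := (lap_op E pi (theta_gt0 := theta_gt0)).

Lemma adapted_sum x (B : {fset G}) :
  \sum_(y <- B) pi x y * rho x y ^+ 2 <= theta x.
Proof.
have h0 y : 0 <= pi x y * rho x y ^+ 2.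
  by rewrite mulr_ge0 ?sqr_ge0// (weight_ge0 weight_pi).
apply: le_trans (ler_fsum_subset h0 (fsubsetUr (nbf E x) B)) _.
rewrite -(big_fset_incl _ (fsubsetUl (nbf E x) B)) => [|y _]; last first.
  by rewrite (in_nbf graphE) => /(weight_eq0 weight_pi) ->; rewrite mul0r.
have := adapted_rho.1 x; rewrite fsbig_finite; last exact: edge_locally_finite.
by rewrite ler_pdivrMl// mulr1.
Qed.

Lemma nnsum_approx (p : G -> R) e : nnsummable p -> 0 < e ->
  exists A : {fset G}, nnsum p - e <= \sum_(x <- A) p x.
Proof.
move=> ps e0; apply: contrapT => h.
have : nnsum p <= nnsum p - e.
  apply: (nnsummable_le ps.1 _).2 => A; rewrite leNgt; apply/negP => hA.
  by apply: h; exists A; exact: ltW.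
lra.
Qed.

Lemma seq_min (s : seq G) (F : G -> R) : (forall x, 0 < F x) ->
  exists2 m, 0 < m & forall x, x \in s -> m <= F x.
Proof.
move=> F0; elim: s => [|v s [m m0 hm]]; first by exists 1.
exists (Num.min m (F v)) => [|x]; first by rewrite lt_min m0 F0.
by rewrite inE => /orP[/eqP ->|/hm mx]; rewrite ge_min ?mx ?lexx ?orbT.
Qed.

(* The superlevel set {F >= eta} has finite mass, so its components are finite;
   h = F - eta on finitely many of them. *)
Lemma truncation (F : G -> R) (L : R) : (forall x, 0 < F x) -> L2 theta F ->
  (forall x y, E x y -> `|F x - F y| <= L * rho x y * F x) ->
  exists h : l2, [/\ Cc h, forall x, 0 <= h x <= F x,
    nnsum (fun x => F x ^+ 2 * theta x) <= 8 * dot h h &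
    dot (lap h) h <= 2^-1 * (L ^+ 2 * nnsum (fun x => F x ^+ 2 * theta x))].
Proof.
move=> F0 FL2 lip.
have /(L2P theta_gt0) Fs := FL2.
set N := nnsum _.
have [A hA] : exists A : {fset G}, N / 2 <= \sum_(x <- A) F x ^+ 2 * theta x.
  have [N0|N0] := leP N 0.
    exists fset0; rewrite big_seq_fset0; lra.
  have [A hA] := nnsum_approx Fs (divr_gt0 N0 (ltr0n R 2)).
  by exists A; apply: le_trans hA; rewrite -/N; lra.
have [m m0 hm] := seq_min A F0.
(* With [eta] half a lower bound of [F] on [A], F - eta is at least F / 2 there. As [A] carries half
   of [N], this gives the factor 8 = 2 * 4. *)
pose eta := m / 2; have eta0 : 0 < eta by rewrite /eta; lra.
pose B := [set x | (eta <= F x)%R].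
have AB x : x \in A -> B x by move=> /hm; rewrite /B /= /eta; lra.
pose U : {fset G} := (\bigcup_(a <- A) fset_set (reach E B a))%fset.
have UP x : x \in U <-> exists2 a, a \in A & reach E B a x.
  have fin a : a \in A -> finite_set (reach E B a).
    move=> /AB Ba; apply: (reach_finite graphE theta_infinite) => //.
    exact: (mass_level theta_gt0).
  split=> [/bigfcupP[a /andP[aA _]]|[a aA ax]].
    by rewrite in_fset_set ?inE//; [exists a | exact: fin].
  by apply/bigfcupP; exists a; rewrite ?aA// in_fset_set ?inE//; exact: fin.
have UB x : x \in U -> B x.
  by move=> /UP[a /AB Ba]; exact: reach_sub.
have Uedge x y : E x y -> x \in U -> B y -> y \in U.
  move=> xy /UP[a aA ax] By; apply/UP; exists a => //.
  by apply: reach_trans ax _; exact: reach_edge.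
pose hf x := if x \in U then F x - eta else 0.
have hU x : x \notin U -> hf x = 0 by rewrite /hf => /negPf ->.
pose h : l2 := mkl2 theta_gt0 (L2_finite theta_gt0 hU).
have hE x : h x = hf x by [].
(* [U] is a union of whole components of [B], so an edge leaving [U] ends where [F < eta]. On each
   edge meeting [U], [hf] is therefore the positive part of F - eta. *)
have hedge x y : E x y -> `|hf x - hf y| <= `|F x - F y|.
  move=> xy; rewrite /hf.
  case: ifPn => xU; case: ifPn => yU.
  - by rewrite opprB addrA subrK.
  - have yB : F y < eta.
      by rewrite ltNge; apply: contra yU => yB; exact: Uedge xy xU yB.
    have xB : eta <= F x by exact: (UB _ xU).
    by rewrite subr0 [leLHS]ger0_norm ?[leRHS]ger0_norm; lra.
  - have xB : F x < eta.
      rewrite ltNge; apply: contra xU => xB.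
      by apply: (Uedge y) yU xB; rewrite (edge_sym graphE).
    have yB : eta <= F y by exact: (UB _ yU).
    by rewrite sub0r normrN (distrC (F x)) [leLHS]ger0_norm ?[leRHS]ger0_norm; lra.
  - by rewrite subrr normr0.
have h0 x : 0 <= h x <= F x.
  rewrite hE /hf; case: ifPn => xU; last by rewrite lexx ltW.
  have : eta <= F x by exact: (UB _ xU).
  by move=> ?; apply/andP; split; lra.
exists h; split=> //; first by exists U.
  have hs : nnsummable (fun x => h x ^+ 2 * theta x).
    exact: (L2P theta_gt0 h).1 (l2_L2 h).
  have -> : dot h h = nnsum (fun x => h x ^+ 2 * theta x) by exact: dot_fun_sqr.
  have : \sum_(x <- A) F x ^+ 2 * theta x <= 4 * \sum_(x <- A) h x ^+ 2 * theta x.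
    rewrite mulr_sumr [leLHS]big_seq [leRHS]big_seq; apply: ler_sum => x xA.
    rewrite mulrA ler_wpM2r ?(ltW (theta_gt0 x))//.
    have xU : x \in U by apply/UP; exists x => //; exists [::].
    have := hm _ xA; rewrite hE /hf xU /eta => mF.
    have -> : 4 * (F x - m / 2) ^+ 2 = (2 * (F x - m / 2)) ^+ 2 by ring.
    rewrite ler_sqr ?nnegrE; last 2 first.
    - exact: ltW.
    - lra.
    - lra.
  have := nnsum_ge A hs; lra.
rewrite ipC (dot_Cc_r graphE weight_pi h (A := U))//.
rewrite ler_pM2l ?invr_gt0//.
apply: (@le_trans _ _ (L ^+ 2 * \sum_(x <- nbhd E U) F x ^+ 2 * theta x)); last first.
  by rewrite ler_wpM2l ?sqr_ge0// nnsum_ge.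
rewrite mulr_sumr; apply: ler_sum => x _.
(* The edge estimate involves [F] at [x] only, so the sum over [y] reduces to the one that
   adaptedness bounds by [theta x]. *)
apply: (@le_trans _ _ (L ^+ 2 * F x ^+ 2 * \sum_(y <- nbhd E U) pi x y * rho x y ^+ 2)).
  rewrite mulr_sumr; apply: ler_sum => y _; rewrite !hE.
  have [xy|nxy] := boolP (E x y); last first.
    by rewrite (weight_eq0 weight_pi nxy) !mul0r mulr0.
  rewrite [leRHS]mulrCA ler_wpM2l ?(weight_ge0 weight_pi)//.
  have -> : L ^+ 2 * F x ^+ 2 * rho x y ^+ 2 = (L * rho x y * F x) ^+ 2 by ring.
  rewrite -expr2 -(real_normK (num_real (hf x - hf y))).
  have h1 := le_trans (hedge x y xy) (lip x y xy).
  by rewrite ler_sqr ?nnegrE// (le_trans _ h1).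
rewrite mulrA ler_wpM2l//; last exact: adapted_sum.
by rewrite mulr_ge0 ?sqr_ge0.
Qed.

Lemma l2_truncate (v : l2) e : 0 < e -> exists A : {fset G}, exists v' : l2,
  [/\ forall x, x \in A -> v' x = v x, forall x, x \notin A -> v' x = 0 &
      nrm dot (v - v') <= e].
Proof.
move=> e0.
have vs : nnsummable (fun x => v x ^+ 2 * theta x).
  exact: (L2P theta_gt0 v).1 (l2_L2 v).
have [A hA] := nnsum_approx vs (exprn_gt0 2 e0).
pose f x := if x \in A then v x else 0.
have fA x : x \notin A -> f x = 0 by rewrite /f => /negPf ->.
pose v' : l2 := mkl2 theta_gt0 (L2_finite theta_gt0 fA).
have v'E x : v' x = f x by [].
exists A, v'; split=> // [x xA|]; first by rewrite v'E /f xA.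
rewrite -ler_sqr ?nnegrE ?nrm_ge0 ?(ltW e0)// nrm_sqr.
have -> : dot (v - v') (v - v') = dot v v - dot v' v'.
  rewrite !ipE (ipC dot v' v).
  suff -> : dot v v' = dot v' v' by ring.
  rewrite !l2dotE; congr isum; apply/funext => x.
  by rewrite v'E /f; case: ifP; rewrite ?mulr0// mul0r.
have -> : dot v v = nnsum (fun x => v x ^+ 2 * theta x) by exact: dot_fun_sqr.
rewrite l2dotE (isum_fset (A := A)) => [|x xA]; last by rewrite v'E fA// mulr0 mul0r.
suff -> : \sum_(x <- A) v' x * v' x * theta x = \sum_(x <- A) v x ^+ 2 * theta x by lra.
by apply: eq_big_seq => x xA; rewrite v'E /f xA expr2.
Qed.

(** Split [v] into a finitely supported part, whose pairing is bounded through [W], and a remainder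
    of norm at most [e]. Since [C] is the same for all [h] below [W], normalized [h] of large norm
    are nearly orthogonal to [v]. *)
Lemma dot_bound (v : l2) (W : G -> R) e : 0 < e ->
  exists2 C, 0 <= C & forall h : l2, (forall x, `|h x| <= W x) ->
    `|dot v h| <= C + e * nrm dot h.
Proof.
move=> e0; have [A [v' [v'v v'0 vv']]] := l2_truncate v e0.
exists (\sum_(x <- A) `|v' x| * `|W x| * theta x).
  by apply: sumr_ge0 => x _; rewrite !mulr_ge0// ltW.
move=> h hW.
have -> : dot v h = dot v' h + dot (v - v') h by rewrite !ipE; ring.
apply: le_trans (ler_normD _ _) (lerD _ _); last first.
  by apply: le_trans (dot_nrm _ _ _) _; rewrite ler_wpM2r// nrm_ge0.
rewrite l2dotE (isum_fset (A := A)) => [|x xA]; last by rewrite v'0// !mul0r.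
apply: le_trans (ler_norm_sum _ _ _) _; apply: ler_sum => x _.
rewrite !normrM (gtr0_norm (theta_gt0 x)) ler_wpM2r ?(ltW (theta_gt0 x))//.
by rewrite ler_wpM2l//; apply: le_trans (hW x) (ler_norm _).
Qed.

Lemma dot_bound_seq (s : seq l2) (W : G -> R) e : 0 < e ->
  exists2 C, 0 <= C & forall h : l2, (forall x, `|h x| <= W x) ->
    forall v, v \in s -> `|dot v h| <= C + e * nrm dot h.
Proof.
move=> e0; elim: s => [|v s [C C0 hC]]; first by exists 0.
have [C' C'0 hC'] := dot_bound v W e0.
exists (C + C'); first by rewrite addr_ge0.
move=> h hW w; rewrite inE => /orP[/eqP ->|ws].
  have := hC' h hW; lra.
have := hC h hW w ws; lra.
Qed.

Lemma mass_unbounded (K : R) : exists A : {fset G}, K <= \sum_(x <- A) theta x.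
Proof.
apply: contrapT => h.
have := theta_infinite (vertices_infinite graphE) (edge_connected graphE).
suff : (mass theta setT <= K%:E)%E by move=> + e; rewrite e leye_eq.
apply: esum_le_bound => A _; rewrite leNgt; apply/negP => hA.
by apply: h; exists A; exact: ltW.
Qed.

End Truncation.

(** * Exponential test functions *)

Section TestFunctions.
Variables (R : realType) (G : countType).
Variables (E : rel G) (pi : G -> G -> R) (theta : G -> R) (rho : G -> G -> R).
Variable x0 : G.
Hypothesis graphE : is_graph E.
Hypothesis weight_pi : is_edge_weight E pi.
Hypothesis theta_gt0 : forall x, 0 < theta x.
Hypothesis theta_infinite : forall U : set G,
  infinite_set U -> graph_connected E U -> mass theta U = +oo%E.
Hypothesis metric_rho : is_metric rho.
Hypothesis adapted_rho : adapted E pi theta rho.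
Hypothesis growth : (volume_growth theta rho x0 < +oo)%E.

Local Notation l2 := (l2 theta_gt0).
Local Notation dot := (l2dot theta_gt0).
Local Notation lap := (lap_op E pi (theta_gt0 := theta_gt0)).
Local Notation r := (rho x0).

(** It equals exp (a r) up to distance [j] and exp (a (2 j - r)) beyond. *)
Definition peak (a : R) (j : nat) x : R := expR (a * (j%:R - `|r x - j%:R|)).

Lemma peak_le (a : R) j x : 0 <= a -> peak a j x <= expR (a * r x).
Proof.
move=> a0; rewrite ler_expR ler_wpM2l//.
by have := ler_norm (- (r x - j%:R)); rewrite normrN; lra.
Qed.

Lemma peak_ge1 (a : R) j x : 0 <= a -> r x <= j%:R -> 1 <= peak a j x.
Proof.
move=> a0 rj; rewrite /peak -[leLHS]expR0 ler_expR mulr_ge0//.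
rewrite ler0_norm; last by lra.
by have := Defs.metric_ge0 metric_rho x0 x; lra.
Qed.

(** The square is at most exp (4 a j) exp (- 2 a r), and 2 a is the exponent [K + 1] for which the
    weight is summable. *)
Lemma peak_L2 (K a : R) j : 0 <= a -> K + 1 = 2 * a ->
  nnsummable (fun x => expR (- (K + 1) * r x) * theta x) -> L2 theta (peak a j).
Proof.
move=> a0 Ka ws; apply/(L2P theta_gt0).
have [s _] := nnsummableZ (expR_ge0 (4 * a * j%:R)) ws.
apply: (nnsummable_dom _ _ s).1 => x.
  by rewrite mulr_ge0 ?sqr_ge0// ltW.
rewrite mulrA ler_wpM2r ?(ltW (theta_gt0 x))//.
rewrite /peak -expRM_natl -expRD ler_expR Ka.
have : a * (j%:R - `|r x - j%:R|) <= a * (2 * j%:R - r x).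
  by rewrite ler_wpM2l//; have := ler_norm (r x - j%:R); lra.
lra.
Qed.

(** The logarithm of [peak] is [a]-Lipschitz for [rho], by the triangle inequality. The edge length
    bound [c] turns this into an estimate relative to the value at [x]. *)
Lemma peak_lip (a c : R) j x y : 0 <= a -> rho x y <= c ->
  `|peak a j x - peak a j y| <= a * expR (a * c) * rho x y * peak a j x.
Proof.
move=> a0 xyc.
pose s := a * (`|r x - j%:R| - `|r y - j%:R|).
have r0 := Defs.metric_ge0 metric_rho x y.
have sxy : `|s| <= a * rho x y.
  rewrite normrM (ger0_norm a0) ler_wpM2l//.
  apply: le_trans (ler_dist_dist _ _) _.
  have := Defs.metric_triangle metric_rho x0 x y.
  have := Defs.metric_triangle metric_rho x0 y x.
  rewrite (Defs.metric_sym metric_rho y x).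
  by rewrite ler_norml => ? ?; apply/andP; split; lra.
have -> : peak a j x - peak a j y = peak a j x * (1 - expR s).
  rewrite mulrBr mulr1 /peak -expRD; congr (_ - expR _); rewrite /s; ring.
rewrite normrM ger0_norm ?expR_ge0// mulrC ler_wpM2r ?expR_ge0//.
apply: le_trans (expR_sub1_le _) _.
have -> : a * expR (a * c) * rho x y = a * rho x y * expR (a * c) by ring.
apply: ler_pM => //; rewrite ?expR_ge0//.
by rewrite ler_expR; apply: le_trans sxy _; rewrite ler_wpM2l.
Qed.

Lemma test_functions : exists2 L : R, 0 <= L & forall (s : seq l2) e, 0 < e ->
  exists h, [/\ dom E pi h, h != 0, dot (lap h) h <= L * dot h h &
    forall v, v \in s -> `|dot v h| <= e * nrm dot h].
Proof.
have [c c0 hc] := adapted_rho.2.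
have [K [M [K0 M0 vol]]] := volume_growth_exp growth.
have ws := exp_weight_summable theta_gt0 (Defs.metric_ge0 metric_rho x0) K0 M0 vol.
pose a := (K + 1) / 2; have a0 : 0 <= a by rewrite /a; lra.
have Ka : K + 1 = 2 * a by rewrite /a; lra.
pose L := a * expR (a * c).
(* The truncation has energy at most L^2 N / 2, and [N] is at most 8 times its squared norm. *)
exists (4 * L ^+ 2); first by rewrite mulr_ge0// sqr_ge0.
move=> s e e0.
have e2 : 0 < e / 2 by lra.
have [C C0 hC] := dot_bound_seq s (fun x => expR (a * r x)) e2.
(* Once the norm of [h] is at least [B], the constant [C] is absorbed into half of [e * nrm dot h].
   To reach this norm, [j] is taken so large that the ball where [peak] is at least 1 has mass at
   least 8 (B^2 + 1). *)
pose B := C / (e / 2).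
have B0 : 0 <= B by rewrite divr_ge0// ltW.
have [A hA] := mass_unbounded graphE theta_infinite (8 * (B ^+ 2 + 1)).
have [j hj] : exists j : nat, forall x, x \in A -> r x <= j%:R.
  exists (\max_(x <- A) (Num.truncn (r x))).+1 => x xA.
  have /andP[_ /ltW h] := truncn_itv (Defs.metric_ge0 metric_rho x0 x).
  by apply: le_trans h _; rewrite ler_nat ltnS; apply: (leq_bigmax_seq x).
have pL2 := peak_L2 j a0 Ka ws.
have [h [Ch h0 hN hE]] := truncation graphE weight_pi theta_gt0 theta_infinite
  adapted_rho (fun x => expR_gt0 _) pL2
  (fun x y xy => peak_lip j a0 (hc x y xy)).
move: hN hE; set N := nnsum _ => hN hE.
have NA : 8 * (B ^+ 2 + 1) <= N.
  apply: le_trans hA _; apply: le_trans (nnsum_ge A ((L2P theta_gt0 _).1 pL2)).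
  rewrite [leLHS]big_seq [leRHS]big_seq; apply: ler_sum => x xA.
  rewrite ler_peMl ?(ltW (theta_gt0 x))// -[1](expr1n _ 2).
  by rewrite ler_sqr ?nnegrE ?expR_ge0// peak_ge1// hj.
have hh : B ^+ 2 + 1 <= dot h h by lra.
have Bh : B <= nrm dot h.
  by rewrite -ler_sqr ?nnegrE ?nrm_ge0// nrm_sqr; lra.
exists h; split.
- exact: (Cc_dom _ graphE).
- apply/eqP => h00; move: hh; rewrite h00 ip0l; have := sqr_ge0 B; lra.
- apply: le_trans hE _.
  by have := ler_wpM2l (sqr_ge0 L) hN; rewrite -/L; lra.
- move=> v vs; apply: le_trans (hC h _ v vs) _.
    move=> x; have /andP[hx hF] := h0 x.
    by rewrite ger0_norm//; apply: le_trans hF (peak_le _ _ _).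
  have : C <= e / 2 * nrm dot h.
    by rewrite -ler_pdivrMl// mulrC.
  lra.
Qed.

End TestFunctions.

Theorem corollary1p6 (R : realType) (G : countType)
    (E : rel G) (pi : G -> G -> R) (theta : G -> R) (x0 : G)
    (graphE : is_graph E)
    (weight_pi : is_edge_weight E pi)
    (theta_gt0 : forall x, 0 < theta x)
    (theta_infinite : forall U : set G,
       infinite_set U -> graph_connected E U -> mass theta U = +oo%E)
    (adapted_metric : exists rho : G -> G -> R,
       [/\ is_metric rho, adapted E pi theta rho &
           (volume_growth theta rho x0 < +oo)%E]) :
  essential_spectrum theta (laplacian_dom E pi theta)
    (neg_laplacian E pi theta) !=set0.
Proof.
have [rho [metric_rho adapted_rho growth]] := adapted_metric.
apply: contrapT => ess0.
set A := neg_laplacian E pi theta in ess0; set D := laplacian_dom E pi theta in ess0.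
have ess l : ~ essential_spectrum theta D A l by move=> h; apply: ess0; exists l.
have regular_of l : ~ spectrum theta D A l ->
    regular (l2dot theta_gt0) (dom E pi (theta_gt0 := theta_gt0))
      (lap_op E pi (theta_gt0 := theta_gt0)) l.
  by move=> /contrapT; exact: resolvent_regular.
have nlimit l : spectrum theta D A l -> exists2 U, nbhs l U &
    forall y, y != l -> U y -> ~ spectrum theta D A y.
  move=> sl; have nl : ~ limit_point (spectrum theta D A) l.
    by move=> h; apply: (ess l); split=> //; left.
  apply: contrapT => h; apply: nl => U Ul; apply: contrapT => h'; apply: h.
  by exists U => // y yl Uy sy; apply: h'; exists y.
have linA := lap_op_linear pi graphE theta_gt0.
have symA := lap_op_sym graphE weight_pi theta_infinite (theta_gt0 := theta_gt0).
have disc l : exists2 d, 0 < d & forall l', 0 < `|l' - l| -> `|l' - l| < d ->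
    regular (l2dot theta_gt0) (dom E pi (theta_gt0 := theta_gt0))
      (lap_op E pi (theta_gt0 := theta_gt0)) l'.
  have [sl|/regular_of rl] := pselect (spectrum theta D A l); last first.
    have [d d0 hd] := regular_open linA (@l2_complete _ _ _ theta_gt0) rl.
    by exists d; [exact: d0 | move=> l' _; exact: (hd l')].
  have [U /nbhs_ballP[d /= d0 dU] hU] := nlimit l sl.
  exists d; first exact: d0.
  move=> l' l'l l'd; apply: regular_of; apply: hU.
    by rewrite -subr_eq0 -normr_gt0.
  by apply: dU; rewrite /ball /= distrC.
have fin l : exists2 s : seq (l2 theta_gt0),
    (forall e, e \in s -> dom E pi e /\ lap_op E pi e = l *: e) &
    forall h, dom E pi h -> lap_op E pi h = l *: h ->
      perp (l2dot theta_gt0) s h -> h = 0.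
  have [sl|/regular_of rl] := pselect (spectrum theta D A l); last first.
    exists [::]; first by move=> e; rewrite in_nil.
    move=> h Dh he _; apply: (@nrm0_eq0 _ _ (l2dot theta_gt0)).
    have [_ [C _ hC]] := rl; have := hC h Dh.
    rewrite he subrr nrm0 mulr0 => h0.
    by apply/eqP; rewrite eq_le h0 nrm_ge0.
  (* By [nlimit] every point of the spectrum is isolated, so an infinite-dimensional eigenspace
     would put [l] in the essential spectrum. *)
  apply: eigenspace_seq => inf; apply: (ess l); split=> //; right; split=> //.
  have [U Ul hU] := nlimit l sl.
  split; first exact/mem_set.
  exists U => //; apply/seteqP; split=> [y [Uy sy]|_ ->].
    by apply: contrapT => /eqP yl; exact: (hU y yl Uy sy).
  by split=> //; exact: nbhs_singleton Ul.
have [L L0 test] := test_functions graphE weight_pi theta_gt0 theta_infinite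
  metric_rho adapted_rho growth.
(* The level [L + 1] lies strictly above the Rayleigh quotients [L] of the test functions, which
   yields the contradiction. *)
have [s es hs] := rayleigh_unbounded linA symA (@l2_complete _ _ _ theta_gt0)
  (lap_op_ge0 graphE weight_pi theta_infinite (theta_gt0 := theta_gt0))
  disc fin (L + 1).
exact: (rayleigh_test linA symA L0 (fun e es' => (es e es').1) hs test).
Qed.
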